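(* Let $\mathbf{w}\in L^1_{\mathrm{loc}}(\mathbb{R}^N)$ with $\mathbf{w}\ge0$, let $F(R):=\int_{|x|\le R}\mathbf{w}(x)\,dx$, and let $$\overline{\mathbf{w}}(r):=\frac1{|\mathbb{S}^{N-1}|}\int_{\mathbb{S}^{N-1}}\mathbf{w}(r\theta)\,d\sigma(\theta).$$ Consider the problem $$\partial_t u-\Delta u=|u|^p+\mathbf{w}(x)\ \text{ in }(0,\infty)\times\mathbb{R}^N,\qquad u(0,\cdot)=u_0.\qquad(\ast)$$ (1) (Integrable regime, $\gamma=0$.) For $M\in(0,\infty)$: $F(R)\to M$ as $R\to\infty$ if and only if $\mathbf{w}\in L^1(\mathbb{R}^N)$ and $\int_{\mathbb{R}^N}\mathbf{w}\,dx=M$. In that case $F\in\mathrm{RV}_0$, with slowly varying factor $L(R)=F(R)\to M$, and $(\ast)$ admits no global weak solution for $1<p<\frac{N}{N-2}$ ($N\ge3$). (2) (Power regime, $0<\gamma<N$.) If $0<\gamma<N$ and $\overline{\mathbf{w}}(r)\sim c\,r^{-(N-\gamma)}$ as $r\to\infty$ for some $c>0$, then $$F(R)\sim\frac{c\,|\mathbb{S}^{N-1}|}{\gamma}\,R^\gamma\qquad(R\to\infty),$$ so $F\in\mathrm{RV}_\gamma$ with $L(R)=R^{-\gamma}F(R)\to c|\mathbb{S}^{N-1}|/\gamma$. (3) (Borderline regime, $\gamma=0$ with amplification.) If $\overline{\mathbf{w}}(r)\sim c\,r^{-N}$ as $r\to\infty$ for some $c>0$, then $$F(R)\sim c\,|\mathbb{S}^{N-1}|\,\log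 R\qquad(R\to\infty),$$ so $F\in\mathrm{RV}_0$ with $L(R)=F(R)\to\infty$; and for $N\ge3$, $(\ast)$ admits no global weak solution in the closed range $1<p\le\frac{N}{N-2}$, critical exponent included.
   Context: $\sigma$ is the surface measure on the unit sphere $\mathbb{S}^{N-1}$ and $|\mathbb{S}^{N-1}|$ its total mass. Regular variation: a measurable function $V:[A,\infty)\to(0,\infty)$, $A>0$, belongs to $\mathrm{RV}_\rho$ ($\rho\in\mathbb{R}$) if $\lim_{t\to\infty}V(tx)/V(t)=x^\rho$ for every $x>0$. (For $F$ this is understood on $[A,\infty)$ with $A$ so large that $F>0$ there.) Global weak solution: let $p>1$, $u_0\in L^1_{\mathrm{loc}}(\mathbb{R}^N)$, $u_0\ge 0$, $\mathbf{w}\in L^1_{\mathrm{loc}}(\mathbb{R}^N)$. A global weak solution of $(\ast)$ is a function $u\in L^p_{\mathrm{loc}}([0,\infty)\times\mathbb{R}^N)$, $u\ge0$ a.e., such that $$\int_0^T\!\!\int_{\mathbb{R}^N}(|u|^p+\mathbf{w})\varphi\,dx\,dt+\int_{\mathbb{R}^N}u_0\,\varphi(0,x)\,dx=-\int_0^T\!\!\int_{\mathbb{R}^N}u\,\partial_t\varphi\,dx\,dt-\int_0^T\!\!\int_{\mathbb{R}^N}u\,\Delta\varphi\,dx\,dt$$ for every $T>0$ and every nonnegative $\varphi\in C^{1,2}([0,T]\times\mathbb{R}^N)$ (once continuously differentiable in time, twice in space) which is compactly supported in space and satisfies $\varphi(T,\cdot)\equiv0$. ''Admits no global weak solution'' means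 that none exists for any such $u_0$. *)

(* Defs.v *)
From HB Require Import structures.
From mathcomp Require Import all_boot all_order all_algebra.
From mathcomp Require Import all_classical all_reals all_analysis.
From mathcomp Require Import measurable_realfun.

Set Implicit Arguments.
Unset Strict Implicit.
Unset Printing Implicit Defensive.

Import Order.TTheory GRing.Theory Num.Theory.
Import numFieldNormedType.Exports.

Local Open Scope classical_set_scope.
Local Open Scope ring_scope.

(* The Borel sigma-algebra of R^n, as the n-fold product of the Borel
   sigma-algebra of R (same construction as the library's for n.-tuple). *)

Definition rV_display : measure_display. Proof. exact. Qed.

Section rV_measurable.
Context (R : realType) (n : nat).

Let coors : 'I_n -> 'rV[R]_n -> R := fun i x => x ord0 i.

Let rV_set0 : g_sigma_preimage coors set0.
Proof. exact: sigma_algebra0. Qed.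

Let rV_setC A : g_sigma_preimage coors A -> g_sigma_preimage coors (~` A).
Proof. exact: sigma_algebraC. Qed.

Let rV_bigcup (F : _^nat) : (forall i, g_sigma_preimage coors (F i)) ->
  g_sigma_preimage coors (\bigcup_i (F i)).
Proof. exact: sigma_algebra_bigcup. Qed.

HB.instance Definition _ := @isMeasurable.Build rV_display
  'rV[R]_n (g_sigma_preimage coors) rV_set0 rV_setC rV_bigcup.

End rV_measurable.

Lemma measurable_coord (R : realType) n (i : 'I_n) :
  measurable_fun [set: 'rV[R]_n] (fun x : 'rV[R]_n => x ord0 i).
Proof.
move=> _ Y mY; rewrite setTI; apply: sub_sigma_algebra => /=.
rewrite -bigcup_seq/=; exists i => /=; first by rewrite mem_index_enum.
by exists Y => //; rewrite setTI.
Qed.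

Lemma measurable_fun_rVP d (T : measurableType d) (R : realType) n
    (f : T -> 'rV[R]_n) :
  (forall i, measurable_fun [set: T] (fun t => f t ord0 i)) ->
  measurable_fun [set: T] f.
Proof.
move=> mf.
suff : g_sigma_preimage (fun i t => f t ord0 i) `<=` measurable.
  rewrite (g_sigma_preimage_comp (fun i (x : 'rV[R]_n) => x ord0 i) f).
  by move=> h _ A mA; apply: h; exists A.
apply: smallest_sub; first exact: sigma_algebra_measurable.
case: n => [|n] in f mf *; first by rewrite big_ord0.
rewrite -bigcup_mkord_ord; apply: bigcup_sub => i Ii.
by move=> A [B mB <-]; exact: mf.
Qed.

Section rV_cons.
Context (R : realType) (n : nat).

Definition rV_cons (p : R * 'rV[R]_n) : 'rV[R]_n.+1 :=
  \row_i oapp (p.2 ord0) p.1 (unlift ord0 i).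

Definition rV_uncons (y : 'rV[R]_n.+1) : R * 'rV[R]_n :=
  (y ord0 ord0, \row_j y ord0 (lift ord0 j)).

Lemma rV_consK : cancel rV_cons rV_uncons.
Proof.
move=> [x v]; congr pair; first by rewrite mxE unlift_none.
by apply/rowP => j; rewrite !mxE liftK.
Qed.

Lemma measurable_rV_cons : measurable_fun [set: R * 'rV[R]_n] rV_cons.
Proof.
apply: measurable_fun_rVP => i.
rewrite (_ : (fun _ => _) =
  fun p : R * 'rV[R]_n => oapp (p.2 ord0) p.1 (unlift ord0 i)); last first.
  by apply/funext => p; rewrite mxE.
case: (unlift ord0 i) => [j|] /=; last exact: measurable_fst.
apply: (measurableT_comp (measurable_coord j)); exact: measurable_snd.
Qed.

Lemma measurable_rV_uncons : measurable_fun [set: 'rV[R]_n.+1] rV_uncons.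
Proof.
apply/measurable_fun_pairP; split; first exact: measurable_coord.
apply: measurable_fun_rVP => j.
rewrite (_ : (fun _ => _) = fun y : 'rV[R]_n.+1 => y ord0 (lift ord0 j)).
  exact: measurable_coord.
by apply/funext => y; rewrite /= mxE.
Qed.

End rV_cons.

Section cons_measure.
Context (R : realType) (n : nat)
  (m : {sigma_finite_measure set 'rV[R]_n -> \bar R}).

Definition cons_measure : set 'rV[R]_n.+1 -> \bar R :=
  pushforward (@lebesgue_measure R \x m)%E (@rV_cons R n).

Let mcons := @measurable_rV_cons R n.

Let cons_measure0 : cons_measure set0 = 0%E.
Proof. exact: measure0. Qed.

Let cons_measure_ge0 A : (0 <= cons_measure A)%E.
Proof. exact: measure_ge0. Qed.

Let cons_measure_sigma_additive : semi_sigma_additive cons_measure.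
Proof. exact: measure_semi_sigma_additive. Qed.

HB.instance Definition _ := isMeasure.Build _ _ _ cons_measure
  cons_measure0 cons_measure_ge0 cons_measure_sigma_additive.

Let cons_measure_sigma_finite : sigma_finite setT cons_measure.
Proof.
have /sigma_finiteP[F [FT ndF Foo]] := sigma_finiteT (@lebesgue_measure R).
have /sigma_finiteP[G [GT ndG Goo]] := sigma_finiteT m.
exists (fun k => @rV_uncons R n @^-1` (F k `*` G k)).
  apply/esym; rewrite -subTset => y _.
  have : [set: R] (rV_uncons y).1 by [].
  rewrite FT => -[i _ Fi].
  have : [set: 'rV[R]_n] (rV_uncons y).2 by [].
  rewrite GT => -[j _ Gj].
  exists (maxn i j) => //; split.
    by move: Fi; apply/subsetPset/ndF/leq_maxl.
  by move: Gj; apply/subsetPset/ndG/leq_maxr.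
move=> k; have [mF Fk] := Foo k; have [mG Gk] := Goo k; split.
  rewrite -[X in measurable X]setTI.
  by apply: measurable_rV_uncons => //; exact: measurableX.
rewrite /cons_measure /pushforward -comp_preimage.
rewrite (_ : @rV_uncons R n \o @rV_cons R n = id) ?preimage_id//; last first.
  by apply/funext => p; exact: rV_consK.
by rewrite product_measure1E// lte_mul_pinfty// ge0_fin_numE.
Qed.

HB.instance Definition _ := Measure_isSigmaFinite.Build _ _ _ cons_measure
  cons_measure_sigma_finite.

End cons_measure.

Fixpoint lebesgue_rV (R : realType) n :
    {sigma_finite_measure set 'rV[R]_n -> \bar R} :=
  match n with
  | 0%N => \d_(0 : 'rV[R]_0)
  | k.+1 => cons_measure (lebesgue_rV R k)
  end.

Lemma lebesgue_rV_box (R : realType) n (A : 'I_n -> set R) :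
  (forall i, measurable (A i)) ->
  lebesgue_rV R n [set x : 'rV[R]_n | forall i, A i (x ord0 i)] =
  (\prod_(i < n) lebesgue_measure (A i))%E.
Proof.
elim: n A => [|n IH] A mA.
  by rewrite big_ord0 /= diracE mem_set// => -[].
rewrite big_ord_recl/= /cons_measure /pushforward.
rewrite -(IH (fun i => A (lift ord0 i)))//.
rewrite -product_measure1E//; last first.
- rewrite (_ : [set _ | _] = \bigcap_(i in [set: 'I_n])
      ((fun x : 'rV[R]_n => x ord0 i) @^-1` A (lift ord0 i))); last first.
    by apply/seteqP; split => x /= h i => [_|]; exact: h.
  apply: fin_bigcap_measurable => // i _.
  rewrite -[X in measurable X]setTI; exact: measurable_coord.
- exact: mA.
congr (product_measure1 _ _ _); apply/seteqP; split => -[a v] /=.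
  move=> h; split; first by have := h ord0; rewrite mxE unlift_none.
  by move=> i; have := h (lift ord0 i); rewrite mxE liftK.
by move=> [h1 h2] i; rewrite mxE; case: unliftP => [j ->|->] //=; exact: h2.
Qed.

(* The library's norm on 'rV[R]_n is the sup norm. *)
Definition enorm (R : realType) n (x : 'rV[R]_n) : R :=
  Num.sqrt (\sum_(i < n) x ord0 i ^+ 2).

Lemma measurable_enorm (R : realType) n :
  measurable_fun [set: 'rV[R]_n] (@enorm R n).
Proof.
have ms := continuous_measurable_fun (@sqrt_continuous R).
rewrite (_ : @enorm R n = Num.sqrt \o (fun x => \sum_(i < n) x ord0 i ^+ 2))//.
apply: (measurableT_comp ms).
by apply: measurable_sum => i; apply: measurable_funX; exact: measurable_coord.
Qed.

Definition esphere (R : realType) n : set 'rV[R]_n := [set x | enorm x = 1].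

Section surface_measure.
Context (R : realType) (n : nat).

Definition direction (x : 'rV[R]_n) : 'rV[R]_n := (enorm x)^-1 *: x.

Definition punctured_ball : set 'rV[R]_n := [set x | 0 < enorm x <= 1].

(* The surface measure on the unit sphere of R^n, as a measure on R^n carried
   by the sphere: a Borel set A of directions has surface n times the volume
   of the part of the unit ball lying in the cone over A. *)
Definition surface_measure (A : set 'rV[R]_n) : \bar R :=
  (n%:R%:E * lebesgue_rV R n (direction @^-1` A `&` punctured_ball))%E.

Let minv : measurable_fun [set: R] (@GRing.inv R).
Proof.
rewrite -(setUv [set 0 : R]); apply/measurable_funU => //.
  exact: measurableC.
split; first exact: measurable_fun_set1.
apply: open_continuous_measurable_fun; first by rewrite openC; exact: closed_eq.
by move=> x /[!inE]/= /eqP x0; exact: inv_continuous.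
Qed.

Let mdirection : measurable_fun [set: 'rV[R]_n] direction.
Proof.
apply: measurable_fun_rVP => i.
rewrite (_ : (fun _ => _) =
    fun x : 'rV[R]_n => (enorm x)^-1 * x ord0 i); last first.
  by apply/funext => x; rewrite mxE.
apply: measurable_funM; last exact: measurable_coord.
exact: (measurableT_comp minv (@measurable_enorm R n)).
Qed.

Let mpball : measurable punctured_ball.
Proof.
rewrite (_ : punctured_ball = @enorm R n @^-1` `]0, 1]%classic).
  rewrite -[X in measurable X]setTI; apply: measurable_enorm => //.
by apply/seteqP; split => x /=; rewrite in_itv.
Qed.

Let cone : set 'rV[R]_n -> \bar R :=
  pushforward (mrestr (lebesgue_rV R n) mpball) direction.

Let cone0 : cone set0 = 0%E. Proof. exact: measure0. Qed.

Let cone_ge0 A : (0 <= cone A)%E. Proof. exact: measure_ge0. Qed.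

Let cone_sigma_additive : semi_sigma_additive cone.
Proof. exact: measure_semi_sigma_additive. Qed.

HB.instance Definition _ := isMeasure.Build _ _ _ cone
  cone0 cone_ge0 cone_sigma_additive.

Let surface_measureE : surface_measure = mscale (n%:R%:nng)%R cone.
Proof. by []. Qed.

Let surface_measure0 : surface_measure set0 = 0%E.
Proof. rewrite surface_measureE; exact: measure0. Qed.

Let surface_measure_ge0 A : (0 <= surface_measure A)%E.
Proof. rewrite surface_measureE; exact: measure_ge0. Qed.

Let surface_measure_sigma_additive : semi_sigma_additive surface_measure.
Proof. rewrite surface_measureE; exact: measure_semi_sigma_additive. Qed.

HB.instance Definition _ := isMeasure.Build _ _ _ surface_measure
  surface_measure0 surface_measure_ge0 surface_measure_sigma_additive.

End surface_measure.

Section pde.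
Context (R : realType) (N : nat).
Local Notation space := 'rV[R]_N.
Local Notation dx := (lebesgue_rV R N).
Local Notation dtdx := (@lebesgue_measure R \x lebesgue_rV R N)%E.

Definition L1loc (f : space -> R) : Prop :=
  measurable_fun [set: space] f /\
  forall K : set space, compact K -> dx.-integrable K (EFin \o f).

Definition half_space : set (R * space) := [set z | 0 <= z.1].

Definition Lploc (p : R) (u : R * space -> R) : Prop :=
  measurable_fun half_space u /\
  forall K : set (R * space), compact K -> K `<=` half_space ->
    dtdx.-integrable K (fun z => (`|u z| `^ p)%:E).

Definition closed_slab (T : R) : set (R * space) := [set z | 0 <= z.1 <= T].

Definition open_slab (T : R) : set (R * space) := [set z | 0 < z.1 < T].

Definition time_deriv (phi : R * space -> R) (z : R * space) : R :=
  derive1 (fun t => phi (t, z.2)) z.1.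

Definition space_deriv (i : 'I_N) (phi : R * space -> R) (z : R * space) : R :=
  'D_(delta_mx 0 i) (fun x => phi (z.1, x)) z.2.

Definition laplacian (phi : R * space -> R) (z : R * space) : R :=
  \sum_(i < N) space_deriv i (space_deriv i phi) z.

(* C^1 in time on the closed interval [0, T]: the time derivative in the open
   slab extends continuously to the closed slab. *)
Definition C1_time (T : R) (phi : R * space -> R) : Prop :=
  (forall z, open_slab T z -> derivable (fun t => phi (t, z.2)) z.1 1) /\
  exists2 g : R * space -> R, {within closed_slab T, continuous g} &
    {in open_slab T, time_deriv phi =1 g}.

Definition C1_space (T : R) (phi : R * space -> R) : Prop :=
  forall i : 'I_N,
    (forall z, closed_slab T z ->
       derivable (fun x => phi (z.1, x)) z.2 (delta_mx 0 i)) /\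
    {within closed_slab T, continuous (space_deriv i phi)}.

Definition C12 (T : R) (phi : R * space -> R) : Prop :=
  [/\ {within closed_slab T, continuous phi}, C1_time T phi, C1_space T phi
    & forall i : 'I_N, C1_space T (space_deriv i phi)].

Definition test_function (T : R) (phi : R * space -> R) : Prop :=
  [/\ C12 T phi,
      forall z, closed_slab T z -> 0 <= phi z,
      exists2 K : set space, compact K &
        forall z, closed_slab T z -> ~ K z.2 -> phi z = 0
    & forall x, phi (T, x) = 0].

Definition global_weak_solution (p : R) (w u0 : space -> R)
    (u : R * space -> R) : Prop :=
  [/\ Lploc p u,
      {ae dtdx, forall z, half_space z -> 0 <= u z}
    & forall (T : R) (phi : R * space -> R), 0 < T -> test_function T phi ->
      (\int[dtdx]_(z in open_slab T) ((`|u z| `^ p + w z.2) * phi z))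
        + (\int[dx]_x (u0 x * phi (0, x)))
      = - (\int[dtdx]_(z in open_slab T) (u z * time_deriv phi z))
        - (\int[dtdx]_(z in open_slab T) (u z * laplacian phi z))].

Definition no_global_weak_solution (p : R) (w : space -> R) : Prop :=
  forall u0 : space -> R, L1loc u0 -> {ae dx, forall x, 0 <= u0 x} ->
  ~ exists u, global_weak_solution p w u0 u.

Definition sphere_area : R := fine (@surface_measure R N (@esphere R N)).

Definition spherical_mean (w : space -> R) (r : R) : R :=
  sphere_area^-1 *
  \int[@surface_measure R N]_(theta in @esphere R N) w (r *: theta).

Definition ball_mass (w : space -> R) (r : R) : R :=
  \int[dx]_(x in [set x | enorm x <= r]) w x.

End pde.

Section regular_variation.
Context (R : realType).
Implicit Types (rho : R) (V L f g : R -> R).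

Definition asymp_equiv f g : Prop := f t / g t @[t --> +oo] --> (1 : R).

Definition RV rho V : Prop :=
  exists A : R, [/\ 0 < A, measurable_fun `[A, +oo[%classic V,
    (forall t, A <= t -> 0 < V t)
  & forall x, 0 < x -> V (t * x) / V t @[t --> +oo] --> x `^ rho].

(* V(t) = t^rho L(t) with L slowly varying. *)
Definition RV_with_factor rho V L : Prop :=
  [/\ RV rho V, RV 0 L & \forall t \near +oo, V t = t `^ rho * L t].

End regular_variation.

(* Main.v *)
From HB Require Import structures.
Require Import Defs.
From mathcomp Require Import all_boot all_order all_algebra.
From mathcomp Require Import all_classical all_reals all_analysis.
From mathcomp Require Import measurable_realfun.
From mathcomp Require Import ring lra.

Set Implicit Arguments.
Unset Strict Implicit.
Unset Printing Implicit Defensive.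

Import Order.TTheory GRing.Theory Num.Theory.
Import numFieldNormedType.Exports.

Local Open Scope classical_set_scope.
Local Open Scope ring_scope.

(** Everything about the growth of the ball mass F comes from one change of
variables, and everything about nonexistence from one test function.

Growth. The map x |-> (|x|^N / N, x / |x|) carries the volume of R^N, off the
origin, to the product of the length on ]0, +oo[ and the surface measure
([polar_measure]): on a rectangle this is the homogeneity of volume together
with the definition of surface measure by cones. Integrating w along this map
gives F(r) as |S| times the integral over 0 < s <= r^N / N of the spherical mean
of w at the radius (N s)^(1/N) ([ball_mass_polar]). If the spherical mean is
equivalent to c r^-(N - gamma), or to c r^-N, the integrand is equivalent to an
explicit function with an explicit primitive tending to +oo, and equivalence
passes to the primitives ([asymp_integral]); evaluating these primitives at
s = r^N / N yields c |S| r^gamma / gamma, or c |S| log r. Regular variation is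
inherited from any equivalent function ([RV_asymp_equiv]). That F has the finite
limit M exactly when w is integrable with integral M is monotone convergence.

Nonexistence. Test the equation against phi = Y^k X^k with Y = 1 - t / T and
X = max(1 - |x|^2 / rho^2, 0). Differentiation costs at most two powers of X and
one of Y, so that |phi_t| + |Delta phi| <= d B, where d = O(1/T + 1/rho^2) and
B^p <= phi once k is large. Young's inequality u d B <= (u B)^p + d^q, with
q = p / (p - 1), then bounds the right-hand side of the weak equation by the
integral of |u|^p phi, which cancels against the left-hand side, plus d^q times
the volume of a box containing the support ([bump_absorb]). The initial datum
contributes a nonnegative term, so with T = rho^2 one gets
F(rho / 2) <= C rho^(N - 2 q) ([weak_solution_growth]). For N >= 3 the exponent
is negative when p < N / (N - 2) and vanishes at p = N / (N - 2): the first case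
contradicts F -> M > 0, and both contradict F -> +oo. *)

(* The measure structures on image and restricted measures take a proof of
   measurability, which unification cannot supply: they are named here so as to
   be given explicitly. *)
Local Notation pushforward_measure :=
  measure_function_pushforward__canonical__measure_function_Measure.
Local Notation mscale_measure :=
  measure_function_mscale__canonical__measure_function_Measure.
Local Notation mrestr_measure :=
  measure_function_mrestr__canonical__measure_function_Measure.

(** * Homogeneity of volume *)

Lemma lebesgue_measure_scale (R : realType) (c : R) (A : set R) :
  0 < c -> measurable A ->
  (lebesgue_measure ( *%R c @^-1` A) = c^-1%:E * lebesgue_measure A)%E.
Proof.
move=> c0 mA.
have mc : @measurable_fun _ _ (measurableTypeR R) (measurableTypeR R) setT
    ( *%R c) by exact: mulrl_measurable.
have c0' : (0 <= c) by exact: ltW.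
suff -> : lebesgue_measure A = (c%:E * lebesgue_measure ( *%R c @^-1` A))%E.
  by rewrite muleA -EFinM mulVf ?gt_eqF// mul1e.
have H := @lebesgue_measure_unique R (mscale_measure (NngNum c0')
  (pushforward_measure (@lebesgue_measure R) mc)).
rewrite [LHS]H//.
move=> _ [[a b]] _ <-.
rewrite -[RHS]/(c%:E * lebesgue_measure ( *%R c @^-1` `]a, b]))%E.
rewrite lebesgue_measure_itv/=.
rewrite [X in lebesgue_measure X](_ : _ = `]a / c, b / c]%classic).
  rewrite lebesgue_measure_itv/= !lte_fin ltr_pM2r ?invr_gt0//.
  case: ifPn => // _; last by rewrite mule0.
  by rewrite -!EFinB -EFinM -mulrBl mulrCA divff ?mulr1// gt_eqF.
by apply/seteqP; split => x /=; rewrite !in_itv/= ltr_pdivrMr// ler_pdivlMr// mulrC.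
Qed.

Lemma measurable_scale_rV (R : realType) n (c : R) :
  measurable_fun [set: 'rV[R]_n] (fun x : 'rV[R]_n => c *: x).
Proof.
apply: measurable_fun_rVP => i.
rewrite (_ : (fun _ => _) = fun x : 'rV[R]_n => c * x ord0 i).
  by apply: measurable_funM => //; exact: measurable_coord.
by apply/funext => x; rewrite mxE.
Qed.

Lemma measurable_preimage d d' (T : measurableType d) (U : measurableType d')
  (f : T -> U) (A : set U) : measurable_fun [set: T] f -> measurable A ->
  measurable (f @^-1` A).
Proof. by move=> mf mA; rewrite -[X in measurable X]setTI; exact: mf. Qed.

(** By induction on the dimension: the rescaled product measure agrees with the
product measure on rectangles, hence everywhere. *)
Lemma lebesgue_rV_scale (R : realType) n (c : R) (A : set 'rV[R]_n) :
  0 < c -> measurable A ->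
  (lebesgue_rV R n ((fun x => c *: x) @^-1` A) =
   (c ^- n)%:E * lebesgue_rV R n A)%E.
Proof.
move=> c0; elim: n A => [|n IH] A mA.
  rewrite expr0 invr1 mul1e /= !diracE.
  congr (_%:R%:E); congr nat_of_bool; apply/idP/idP; rewrite !inE/=;
    by rewrite scaler0.
rewrite /= /cons_measure /pushforward.
set B := @rV_cons R n @^-1` A.
have mB : measurable B.
  by apply: measurable_preimage => //; exact: measurable_rV_cons.
pose g (p : R * 'rV[R]_n) := (c * p.1, c *: p.2).
have mg : @measurable_fun _ _ (measurableTypeR R * 'rV[R]_n)%type
    (measurableTypeR R * 'rV[R]_n)%type setT g.
  apply/measurable_fun_pairP; split.
    by apply: measurable_funM => //; exact: measurable_fst.
  apply: (measurableT_comp (@measurable_scale_rV R n c)); exact: measurable_snd.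
have -> : @rV_cons R n @^-1` ((fun x => c *: x) @^-1` A) = g @^-1` B.
  apply/seteqP; split => -[a v]; rewrite /B /g /=.
    congr A; apply/rowP => i; rewrite !mxE/=; case: unliftP => //= j _.
    by rewrite mxE.
  congr A; apply/rowP => i; rewrite !mxE/=; case: unliftP => //= j _.
  by rewrite mxE.
have cn0 : 0 <= c ^+ n.+1 by rewrite exprn_ge0// ltW.
pose mu := (@lebesgue_measure R \x lebesgue_rV R n)%E.
pose m' := mscale_measure (NngNum cn0) (pushforward_measure mu mg).
suff -> : ((@lebesgue_measure R \x lebesgue_rV R n) B = m' B)%E.
  rewrite -[m' B]/((c ^+ n.+1)%:E * mu (g @^-1` B))%E.
  rewrite muleA -EFinM mulVf ?mul1e//.
  by rewrite gt_eqF// exprn_gt0.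
have H := @product_measure_unique _ _ (measurableTypeR R) _ R
  (@lebesgue_measure R) (lebesgue_rV R n) m'.
apply: H => // X Y mX mY.
rewrite -[LHS]/((c ^+ n.+1)%:E * mu (g @^-1` (X `*` Y)))%E.
have -> : g @^-1` (X `*` Y) = ( *%R c @^-1` X) `*` ((fun x => c *: x) @^-1` Y).
  by [].
rewrite /mu product_measure1E; last 2 first.
- apply: measurable_preimage => //; exact: mulrl_measurable.
- apply: measurable_preimage => //; exact: measurable_scale_rV.
transitivity ((c%:E * (c ^+ n)%:E) * ((c^-1%:E * lebesgue_measure X) *
    ((c ^- n)%:E * lebesgue_rV R n Y)))%E.
  rewrite exprS EFinM; congr (_ * (_ * _))%E; last exact: IH.
  exact: lebesgue_measure_scale.
rewrite muleACA [X in (X * _)%E](_ : _ = lebesgue_measure X); last first.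
  by rewrite muleA -EFinM divff ?mul1e// gt_eqF.
congr (_ * _)%E.
by rewrite muleA -EFinM divff ?mul1e// gt_eqF// exprn_gt0.
Qed.

(** * Euclidean balls and boxes *)

Section euclidean_norm.
Context (R : realType) (n : nat).
Implicit Types (x : 'rV[R]_n) (c r : R).

Lemma enorm_ge0 x : 0 <= enorm x.
Proof. exact: sqrtr_ge0. Qed.

Definition sumsq x : R := \sum_(i < n) x ord0 i ^+ 2.

Lemma sumsq_ge0 x : 0 <= sumsq x.
Proof. by apply: sumr_ge0 => i _; exact: sqr_ge0. Qed.

Lemma sqr_enorm x : enorm x ^+ 2 = \sum_(i < n) x ord0 i ^+ 2.
Proof. rewrite sqr_sqrtr//; exact: sumsq_ge0. Qed.

Lemma enormZ c x : 0 <= c -> enorm (c *: x) = c * enorm x.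
Proof.
move=> c0; apply/eqP; rewrite -(@eqrXn2 _ 2)//; last 2 first.
- exact: enorm_ge0.
- by rewrite mulr_ge0// enorm_ge0.
rewrite exprMn !sqr_enorm mulr_sumr; apply/eqP/eq_bigr => i _.
by rewrite mxE exprMn.
Qed.

Lemma ler_coord_enorm x i : `|x ord0 i| <= enorm x.
Proof.
rewrite -(@ler_pXn2r _ 2)// ?nnegrE ?enorm_ge0// sqr_enorm real_normK ?num_real//.
by rewrite (bigD1 i)//= lerDl; apply: sumr_ge0 => j _; exact: sqr_ge0.
Qed.

Lemma enorm_eq0 x : enorm x = 0 -> x = 0.
Proof.
move=> x0; apply/rowP => i; rewrite mxE; apply/eqP; rewrite -normr_le0 -x0.
exact: ler_coord_enorm.
Qed.

Lemma enorm_le_sup x r : 0 <= r -> (forall i, `|x ord0 i| <= r) ->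
  enorm x <= n%:R * r.
Proof.
move=> r0 xr; rewrite -(@ler_pXn2r _ 2)// ?nnegrE ?enorm_ge0 ?mulr_ge0//.
rewrite sqr_enorm; apply: (@le_trans _ _ (\sum_(i < n) r ^+ 2)).
  apply: ler_sum => i _; rewrite -(@real_normK _ (x ord0 i)) ?num_real//.
  by rewrite lerXn2r// nnegrE.
rewrite sumr_const card_ord -[leLHS]mulr_natl exprMn ler_wpM2r ?sqr_ge0//.
by rewrite -natrX ler_nat; case: (n) => // m; rewrite expnS expn1 leq_pmulr.
Qed.

(** Boxes are compact and have an explicit volume, so they serve as compact
neighbourhoods of the Euclidean balls. *)
Definition box r : set 'rV[R]_n := [set x | forall i, x ord0 i \in `[- r, r]].

Lemma compact_box r : compact (box r).
Proof.
apply: (@rV_compact R n (fun=> `[- r, r]%classic)) => i.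
exact: segment_compact.
Qed.

Lemma measurable_box r : measurable (box r).
Proof.
rewrite (_ : box r = \bigcap_(i in [set: 'I_n])
    ((fun x : 'rV[R]_n => x ord0 i) @^-1` `[- r, r]%classic)); last first.
  by apply/seteqP; split => x /= h i => [_|]; exact: h.
apply: fin_bigcap_measurable => // i _.
by apply: measurable_preimage => //; exact: measurable_coord.
Qed.

Lemma lebesgue_rV_boxE r : 0 < r ->
  lebesgue_rV R n (box r) = ((r *+ 2) ^+ n)%:E.
Proof.
move=> r0; rewrite (@lebesgue_rV_box R n (fun=> `[- r, r]%classic))//.
rewrite lebesgue_measure_itv/= lte_fin gtrN// opprK.
elim: (n) => [|m IH]; first by rewrite big_ord0.
by rewrite big_ord_recl/= IH exprS mulr2n.
Qed.

Definition eball r : set 'rV[R]_n := [set x | enorm x <= r].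

Lemma measurable_eball r : measurable (eball r).
Proof.
rewrite (_ : eball r = @enorm R n @^-1` `]-oo, r]%classic); last first.
  by apply/seteqP; split => x /=; rewrite in_itv.
by apply: measurable_preimage => //; exact: measurable_enorm.
Qed.

Lemma eball_box r : eball r `<=` box r.
Proof.
move=> x xr i; rewrite in_itv/= -ler_norml.
exact: (le_trans (ler_coord_enorm x i)).
Qed.

Lemma lebesgue_rV_eball_lty r : (lebesgue_rV R n (eball r) < +oo)%E.
Proof.
apply: (@le_lt_trans _ _ (lebesgue_rV R n (box (Num.max r 1)))).
  apply: le_measure; rewrite ?inE; [exact: measurable_eball|exact: measurable_box|].
  apply: subset_trans (@eball_box _) => x; rewrite /eball/= => xr.
  by rewrite le_max xr.
by rewrite lebesgue_rV_boxE ?ltry// lt_max ltr01 orbT.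
Qed.

Lemma lebesgue_rV_eball_gt0 r : (0 < n)%N -> 0 < r ->
  (0 < lebesgue_rV R n (eball r))%E.
Proof.
move=> n0 r0; apply: (@lt_le_trans _ _ (lebesgue_rV R n (box (r / n%:R)))).
  rewrite lebesgue_rV_boxE ?divr_gt0// ?ltr0n// lte_fin exprn_gt0//.
  by rewrite mulr2n addr_gt0// divr_gt0 ?ltr0n.
apply: le_measure; rewrite ?inE; [exact: measurable_box|exact: measurable_eball|].
move=> x xr; rewrite /eball/=.
rewrite (_ : r = n%:R * (r / n%:R)); last first.
  by rewrite mulrCA divff ?mulr1// pnatr_eq0 -lt0n.
apply: enorm_le_sup => [|i]; first by rewrite divr_ge0// ltW.
by have := xr i; rewrite in_itv/= -ler_norml.
Qed.

Lemma lebesgue_rV_origin : (0 < n)%N -> lebesgue_rV R n [set 0] = 0%E.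
Proof.
move=> n0; rewrite (_ : [set 0] = [set x : 'rV[R]_n | forall i, [set (0:R)] (x ord0 i)]).
  rewrite (@lebesgue_rV_box R n (fun=> [set 0]))//.
  case: n n0 => // m _; rewrite big_ord_recl.
  by rewrite lebesgue_measure_set1 mul0e.
apply/seteqP; split => x /= => [-> i|h]; first by rewrite mxE.
by apply/rowP => i; rewrite h mxE.
Qed.

Lemma measurable_origin : measurable [set (0 : 'rV[R]_n)].
Proof.
rewrite (_ : [set 0] = eball 0); first exact: measurable_eball.
apply/seteqP; split => x /=; rewrite /eball/=.
  by move=> ->; rewrite /enorm big1 ?sqrtr0// => i _; rewrite mxE expr0n.
move=> x0; apply: enorm_eq0; apply/eqP; rewrite eq_le x0; exact: enorm_ge0.
Qed.

End euclidean_norm.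

(** * Polar coordinates *)

Section polar_coordinates.
Context (R : realType) (N : nat) (N0 : (0 < N)%N).
Local Notation space := 'rV[R]_N.
Local Notation dx := (lebesgue_rV R N).
Local Notation sigma := (@surface_measure R N).

Lemma measurable_invr : measurable_fun [set: R] (@GRing.inv R).
Proof.
rewrite -(setUv [set 0 : R]); apply/measurable_funU => //.
  exact: measurableC.
split; first exact: measurable_fun_set1.
apply: open_continuous_measurable_fun; first by rewrite openC; exact: closed_eq.
by move=> x /[!inE]/= /eqP x0; exact: inv_continuous.
Qed.

Lemma measurable_direction : measurable_fun [set: space] (@direction R N).
Proof.
apply: measurable_fun_rVP => i.
rewrite (_ : (fun _ => _) =
    fun x : space => (enorm x)^-1 * x ord0 i); last first.
  by apply/funext => x; rewrite mxE.
apply: measurable_funM; last exact: measurable_coord.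
exact: (measurableT_comp measurable_invr (@measurable_enorm R N)).
Qed.

Lemma surface_measureT_lty : (sigma setT < +oo)%E.
Proof.
rewrite /surface_measure lte_mul_pinfty//.
apply: le_lt_trans (@lebesgue_rV_eball_lty R N 1).
apply: le_measure; rewrite ?inE; [|exact: measurable_eball|].
  rewrite preimage_setT setTI.
  rewrite (_ : @punctured_ball R N = @enorm R N @^-1` `]0, 1]%classic).
    by apply: measurable_preimage => //; exact: measurable_enorm.
  by apply/seteqP; split => x /=; rewrite in_itv.
by move=> x [_ /andP[]].
Qed.

Lemma surface_measure_fin_num : fin_num_fun sigma.
Proof.
move=> A mA; rewrite ge0_fin_numE//; apply: le_lt_trans surface_measureT_lty.
by apply: le_measure; rewrite ?inE.
Qed.

HB.instance Definition _ := Measure_isFinite.Build _ _ _ sigma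
  surface_measure_fin_num.

(** The radial coordinate is normalised so that it carries volume to |S| times the
plain length: the ball of radius r has volume |S| r^N / N. *)
Definition radial (x : space) : R := enorm x ^+ N / N%:R.

Definition radius (s : R) : R := (N%:R * s) `^ (N%:R^-1).

Definition polar (x : space) : R * space := (radial x, direction x).

Let N0R : 0 < N%:R :> R. Proof. by rewrite ltr0n. Qed.

Lemma radius_gt0 s : 0 < s -> 0 < radius s.
Proof. by move=> s0; rewrite powR_gt0// mulr_gt0. Qed.

Lemma radiusX s : 0 <= s -> radius s ^+ N = N%:R * s.
Proof.
move=> s0; rewrite -powR_mulrn ?powR_ge0// -powRrM mulVf ?gt_eqF// powRr1//.
by rewrite mulr_ge0// ltW.
Qed.

Lemma radialK x : radius (radial x) = enorm x.
Proof.
rewrite /radius /radial mulrCA divff ?gt_eqF// mulr1.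
rewrite -powR_mulrn ?enorm_ge0// -powRrM divff ?gt_eqF// powRr1//.
exact: enorm_ge0.
Qed.

Lemma radial_gt0 x : (0 < radial x) = (0 < enorm x).
Proof.
rewrite /radial pmulr_lgt0 ?invr_gt0//.
by rewrite !lt_def enorm_ge0 exprn_ge0 ?enorm_ge0// expf_eq0 N0 !andbT.
Qed.

Lemma radial_le x s : 0 <= s -> (radial x <= s) = (enorm x <= radius s).
Proof.
move=> s0; rewrite /radial ler_pdivrMr// mulrC -radiusX// ler_pXn2r// nnegrE.
- exact: enorm_ge0.
- exact: powR_ge0.
Qed.

Lemma measurable_radial : measurable_fun [set: space] radial.
Proof.
apply: measurable_funM => //; apply: measurable_funX; exact: measurable_enorm.
Qed.

Lemma measurable_polar :
  @measurable_fun _ _ space (measurableTypeR R * space)%type setT polar.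
Proof.
apply/measurable_fun_pairP; split; first exact: measurable_radial.
exact: measurable_direction.
Qed.

Lemma radius_polarK x : radius (polar x).1 *: (polar x).2 = x.
Proof.
rewrite radialK/= /direction; have [x0|x0] := eqVneq (enorm x) 0.
  by rewrite x0 scale0r (enorm_eq0 x0).
by rewrite scalerA divff// scale1r.
Qed.

(** The truncated cone on the left is a dilate of the truncated cone that defines
the surface measure of B, by the factor (N b)^(1/N), whose N-th power is N b. *)
Lemma polar_conic (B : set space) (b : R) : measurable B -> 0 < b ->
  dx (polar @^-1` (`]0, b] `*` B)) = (b%:E * sigma B)%E.
Proof.
move=> mB b0.
have c0 : 0 < (radius b)^-1 by rewrite invr_gt0 radius_gt0.
rewrite (_ : _ @^-1` _ = (fun x => (radius b)^-1 *: x) @^-1`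
    (@direction R N @^-1` B `&` @punctured_ball R N)); last first.
  have E x : enorm ((radius b)^-1 *: x) = (radius b)^-1 * enorm x.
    by rewrite enormZ// ltW.
  have dE x : direction ((radius b)^-1 *: x) = direction x.
    rewrite /direction E scalerA invfM invrK -mulrA mulrCA divff ?mulr1//.
    by rewrite gt_eqF ?radius_gt0.
  have F x : (0 < radial x <= b) = (0 < enorm ((radius b)^-1 *: x) <= 1).
    rewrite radial_gt0 (radial_le x (ltW b0)) E pmulr_rgt0//.
    by rewrite mulrC ler_pdivrMr ?mul1r// radius_gt0.
  apply/seteqP; split => x /=; rewrite in_itv/= /punctured_ball/= dE F.
    by move=> [].
  by move=> [].
rewrite lebesgue_rV_scale//; last first.
  apply: measurableI; first exact: measurable_preimage measurable_direction mB.
  rewrite (_ : @punctured_ball R N = @enorm R N @^-1` `]0, 1]%classic).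
    by apply: measurable_preimage => //; exact: measurable_enorm.
  by apply/seteqP; split => x /=; rewrite in_itv.
rewrite exprVn invrK radiusX ?ltW// /surface_measure.
by rewrite mulrC EFinM muleA.
Qed.

Let P : set R := `]0, +oo[%classic.
Let mP : measurable P. Proof. exact: measurable_itv. Qed.

(** For a fixed set B of directions both sides are measures in A, so it is enough
to compare them on the intervals ]a, b], which are differences of the truncated
cones of [polar_conic]. *)
Lemma polar_measure_rectangle (A : set R) (B : set space) :
  measurable A -> measurable B -> A `<=` P ->
  dx (polar @^-1` (A `*` B)) = (lebesgue_measure A * sigma B)%E.
Proof.
move=> mA mB AP.
have mdB := measurable_preimage measurable_direction mB.
have sB : sigma B = (fine (sigma B))%:E.
  by rewrite fineK//; exact: surface_measure_fin_num.
have sB0 : 0 <= fine (sigma B) by rewrite fine_ge0.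
have mrho : @measurable_fun _ _ space (measurableTypeR R) setT radial.
  exact: measurable_radial.
pose m1 := mscale_measure (NngNum sB0)
  (mrestr_measure (@lebesgue_measure R) mP).
pose m2 := mrestr_measure (pushforward_measure
  (mrestr_measure dx mdB) mrho) mP.
have m1E X :
    (m1 X = (fine (sigma B))%:E * lebesgue_measure (X `&` P))%E.
  by [].
have m2E X : m2 X = dx (polar @^-1` ((X `&` P) `*` B)).
  by [].
suff H : m1 A = m2 A.
  by rewrite -(setIidl AP) -m2E -H m1E sB muleC.
have U := @measure_unique _ R (measurableTypeR R) (@ocitv R)
  (fun n => `]- n%:R, n%:R]%classic) _ _ _ _ m1 m2.
apply: U => //.
- exact: ocitvI.
- by move=> n; exact: is_ocitv.
- exact: bigcup_itvT.
- move=> _ [[a b] _ <-] /=; rewrite m1E m2E.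
  have [b0|b0] := leP b 0.
    rewrite (_ : _ `&` P = set0); last first.
      apply/seteqP; split => // x; rewrite /P/= !in_itv/= andbT => -[/andP[_ xb]].
      by move=> /lt_le_trans/(_ xb); rewrite ltNge b0.
    by rewrite set0X preimage_set0 !measure0 mule0.
  rewrite (_ : _ `&` P = `]Num.max a 0, b]%classic); last first.
    apply/seteqP; split => x; rewrite /P/= !in_itv/= andbT gt_max.
      by move=> [/andP[-> ->] ->].
    by move=> /andP[/andP[-> ->] ->].
  have : 0 <= Num.max a 0 by rewrite le_max lexx orbT.
  move: (Num.max a 0) => c c0.
  rewrite lebesgue_measure_itv/= lte_fin.
  case: ltP => cb; last first.
    rewrite set_itv_ge; last by rewrite bnd_simp -leNgt.
    by rewrite set0X preimage_set0 measure0 mule0.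
  move: c0; rewrite le_eqVlt => /predU1P[<-|c0].
    by rewrite polar_conic// sube0 muleC sB.
  have := polar_conic mB b0.
  rewrite (_ : `]0, b] = `]0, c] `|` `]c, b])%classic; last first.
    by rewrite -itv_bndbnd_setU// bnd_simp// ltW.
  rewrite (_ : (_ `|` _) `*` B = `]0, c]%classic `*` B `|` `]c, b]%classic `*` B);
    last by apply/seteqP; split => x /=; rewrite -/((_ \/ _) /\ _); tauto.
  rewrite preimage_setU measureU; last 3 first.
  - apply: measurable_preimage; first exact: measurable_polar.
    by apply: measurableX.
  - apply: measurable_preimage; first exact: measurable_polar.
    by apply: measurableX.
  - apply/seteqP; split => // x [[/= + _] [/= + _]]; rewrite !in_itv/=.
    by move=> /andP[_ xc] /andP[/lt_le_trans/(_ xc)]; rewrite ltxx.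
  rewrite [X in (X + _)%E](_ : _ = (c%:E * sigma B)%E); last exact: polar_conic.
  rewrite sB => H.
  have : (c * fine (sigma B))%:E \is a fin_num by [].
  move: H; rewrite -!EFinM => + cf.
  move=> /(congr1 (fun z => z - (c * fine (sigma B))%:E)%E).
  rewrite addeAC subee// add0e => ->.
  by rewrite -EFinN -EFinD; congr (_%:E); rewrite mulrBr ![fine _ * _]mulrC.
- move=> k; rewrite m1E; apply: lte_mul_pinfty => //.
  apply: (@le_lt_trans _ _ (@lebesgue_measure R `]- k%:R, k%:R]%classic)).
    apply: le_measure; rewrite ?inE//; first exact: measurableI.
  by rewrite lebesgue_measure_itv/=; case: ifPn => // _; rewrite -EFinB ltry.
Qed.

(** Rectangles form a generating pi-system on which the two measures agree. The
restriction to positive radial coordinate discards the origin, which has no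
direction. *)
Lemma polar_measure (X : set (R * space)) :
  measurable X -> X `<=` P `*` setT ->
  dx (polar @^-1` X) = (@lebesgue_measure R \x sigma)%E X.
Proof.
move=> mX XP.
have mPT : measurable (P `*` [set: space]) by exact: measurableX.
pose m1 := mrestr_measure (pushforward_measure dx measurable_polar) mPT.
pose m2 := mrestr_measure (@lebesgue_measure R \x sigma)%E mPT.
have m1E Y : m1 Y = dx (polar @^-1` (Y `&` P `*` setT)) by [].
have m2E Y : m2 Y = (@lebesgue_measure R \x sigma)%E (Y `&` P `*` setT) by [].
suff H : m1 X = m2 X.
  by move: H; rewrite m1E m2E (setIidl XP).
pose C : set (set (R * space)) :=
  [set C | exists A, measurable A /\ exists B, measurable B /\ C = A `*` B].
have U := @measure_unique _ R (measurableTypeR R * space)%type C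
  (fun n => `]- n%:R, n%:R]%classic `*` setT) _ _ _ _ m1 m2.
apply: U => //.
- rewrite measurable_prod_measurableType //; congr (<<s _ >>).
  rewrite predeqE => Y; split => [[A mA [B mB <-]]|[A [mA [B [mB ->]]]]].
    by exists A; split => //; exists B.
  by exists A => //; exists B.
- move=> /= _ _ [X1 [mX1 [X2 [mX2 ->]]]] [Y1 [mY1 [Y2 [mY2 ->]]]].
  rewrite -setXI; exists (X1 `&` Y1); split; first exact: measurableI.
  by exists (X2 `&` Y2); split => //; exact: measurableI.
- by move=> n; exists `]- n%:R, n%:R]%classic; split => //; exists setT.
- rewrite -setX_bigcupl bigcup_itvT; exact: setXTT.
- move=> _ [A [mA [B [mB ->]]]]; rewrite m1E m2E -setXI setIT.
  rewrite product_measure1E//; last exact: measurableI.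
  by rewrite polar_measure_rectangle//; exact: measurableI.
- move=> k; rewrite m1E -setXI setIT polar_measure_rectangle//.
  + apply: lte_mul_pinfty => //.
      rewrite ge0_fin_numE//.
      apply: (@le_lt_trans _ _ (@lebesgue_measure R `]- k%:R, k%:R]%classic)).
        apply: le_measure; rewrite ?inE//; first exact: measurableI.
      by rewrite lebesgue_measure_itv/=; case: ifPn => // _; rewrite -EFinB ltry.
    exact: surface_measureT_lty.
  + exact: measurableI.
Qed.

End polar_coordinates.

Section ball_mass_polar.
Context (R : realType) (N : nat) (N0 : (0 < N)%N).
Local Notation space := 'rV[R]_N.
Local Notation dx := (lebesgue_rV R N).
Local Notation sigma := (@surface_measure R N).

Lemma integrable_eq_measure d (T : measurableType d)
    (m1 m2 : {measure set T -> \bar R}) (D : set T) (f : T -> \bar R) :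
  (forall A, measurable A -> A `<=` D -> m1 A = m2 A) ->
  m1.-integrable D f -> m2.-integrable D f.
Proof.
move=> m12 /integrableP[mf foo]; apply/integrableP; split => //.
by rewrite -(eq_measure_integral m2 m12).
Qed.

Lemma esphere_polar (x : space) : 0 < radial x -> esphere (polar x).2.
Proof.
rewrite radial_gt0// => x0.
by rewrite /esphere/= /direction enormZ ?invr_ge0 ?enorm_ge0// mulVf// gt_eqF.
Qed.

Lemma measurable_esphere : measurable (@esphere R N).
Proof.
rewrite (_ : @esphere R N = @enorm R N @^-1` [set 1])//.
by apply: measurable_preimage => //; exact: measurable_enorm.
Qed.

Lemma measurable_polar_inv :
  @measurable_fun _ _ (measurableTypeR R * space)%type space setT
    (fun z => radius N z.1 *: z.2).
Proof.
apply: measurable_fun_rVP => i.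
rewrite (_ : (fun _ => _) =
    fun z : measurableTypeR R * space => radius N z.1 * z.2 ord0 i); last first.
  by apply/funext => x; rewrite mxE.
apply: measurable_funM.
  apply: (measurableT_comp (measurable_powR (N%:R^-1))) => //.
  by apply: measurable_funM => //; exact: measurable_fst.
by apply: (measurableT_comp (measurable_coord i)); exact: measurable_snd.
Qed.

Variables (w : space -> R) (mw : measurable_fun setT w) (b : R) (b0 : 0 < b).
Hypothesis iw : dx.-integrable (@eball R N (radius N b)) (EFin \o w).

Let h s := \int[sigma]_(theta in @esphere R N) w (radius N s *: theta).
Let D : set (measurableTypeR R * space) := `]0, b]%classic `*` @esphere R N.
Let f (z : measurableTypeR R * space) : \bar R := (w (radius N z.1 *: z.2))%:E.

Let mD : measurable D.
Proof. apply: measurableX => //; exact: measurable_esphere. Qed.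

Let mf : measurable_fun setT f.
Proof. by apply/measurable_EFinP; exact: (measurableT_comp mw measurable_polar_inv). Qed.

Let fpolar : f \o @polar R N = EFin \o w.
Proof. by apply/funext => x; rewrite /f/= -[radial x]/(polar x).1 radius_polarK. Qed.

Let Dpolar : @polar R N @^-1` D = @eball R N (radius N b) `\` [set 0].
Proof.
apply/seteqP; split => x; rewrite /D /= in_itv/=.
  move=> [/andP[x0 xb] _]; split; first by rewrite /eball/= -(radial_le N0)// ltW.
  move=> xE; move: x0; rewrite radial_gt0//; rewrite xE.
  by rewrite /enorm big1 ?sqrtr0 ?ltxx// => i _; rewrite mxE expr0n.
move=> [xb /eqP x0].
have rx0 : 0 < radial x.
  rewrite radial_gt0// lt_def enorm_ge0 andbT.
  by apply: contra x0 => /eqP/enorm_eq0 ->.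
by split; [rewrite rx0 (radial_le N0)// ltW|exact: (esphere_polar rx0)].
Qed.

Let mpD : measurable (@polar R N @^-1` D).
Proof. exact: (measurable_preimage (@measurable_polar R N) mD). Qed.

Let iwD : dx.-integrable (@polar R N @^-1` D) (f \o @polar R N).
Proof.
rewrite fpolar; apply: integrableS iw => //; first exact: measurable_eball.
by rewrite Dpolar; exact: subDsetl.
Qed.

Let meq A : measurable A -> A `<=` D ->
  pushforward_measure dx (@measurable_polar R N) A
  = (@lebesgue_measure R \x sigma)%E A.
Proof.
move=> mA AD; apply: polar_measure => // -[s x] /AD[/= + _].
by rewrite !in_itv/= andbT => /andP[].
Qed.

Let ifD : (@lebesgue_measure R \x sigma)%E.-integrable D f.
Proof.
apply: (integrable_eq_measure meq).
exact: (integrable_pushforward (@measurable_polar R N)).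
Qed.

Let ifDT : (@lebesgue_measure R \x sigma)%E.-integrable setT (f \_ D).
Proof. by apply/(integrable_mkcond f mD). Qed.

Let F : R -> \bar R := fubini_F sigma (f \_ D).

Let FE s : s \in `]0, b] ->
  F s = (\int[sigma]_(theta in @esphere R N) (w (radius N s *: theta))%:E)%E.
Proof.
move=> sb; rewrite /F /fubini_F [RHS]integral_mkcond; apply: eq_integral => x _.
rewrite !patchE; congr (if _ then _ else _).
by apply/idP/idP; rewrite !inE/=; [move=> []|split].
Qed.

Let F0 s : s \notin `]0, b] -> F s = 0%E.
Proof.
move=> sb; rewrite /F /fubini_F; apply: integral0_eq => x _.
by rewrite patchE; case: ifPn => //; rewrite inE => -[/=]; rewrite (negbTE sb).
Qed.

Let hE s : s \in `]0, b] -> h s = fine (F s).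
Proof. by move=> sb; rewrite FE. Qed.

Let intF : (\int[dx]_(x in @eball R N (radius N b)) (w x)%:E =
  \int[lebesgue_measure]_(s in `]0%R, b]) F s)%E.
Proof.
rewrite (@integral_mkcond _ _ _ lebesgue_measure).
transitivity (\int[lebesgue_measure]_s F s)%E; last first.
  apply: eq_integral => s _; rewrite patchE; case: ifPn => //.
  by rewrite notin_setE/= => sb; rewrite F0//; apply/negP.
rewrite integral12_prod_meas1//.
rewrite -integral_mkcond -(eq_measure_integral _ meq)/=.
rewrite (integral_pushforward (@measurable_polar R N))// fpolar Dpolar.
rewrite [LHS](@negligible_integral _ _ _ dx _ [set 0])//.
- exact: measurable_origin.
- exact: measurable_eball.
- exact: lebesgue_rV_origin.
Qed.

Let iF : lebesgue_measure.-integrable `]0, b] F.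
Proof.
apply: (@integrableS _ _ _ lebesgue_measure setT) => //.
exact: integrable_fubini_F.
Qed.

Let ifine : lebesgue_measure.-integrable `]0, b] (EFin \o (fine \o F)).
Proof.
apply: le_integrable iF => //.
  apply/measurable_EFinP; apply: (measurableT_comp (@fine_measurable R setT measurableT)).
  exact: measurable_int iF.
by move=> s _ /=; case: (F s) => [r||]/=; rewrite ?normr0 ?leey.
Qed.

Lemma integrable_sphere_integral : lebesgue_measure.-integrable `]0, b] (EFin \o h).
Proof.
by apply: eq_integrable ifine => // s /[!inE] sb; rewrite /= hE.
Qed.

(** Fubini's theorem after [polar_measure]. The inner integral is finite for almost
every s, so nothing changes when it is replaced by its real-valued version, which
is 0 where the integral diverges. *)
Lemma ball_mass_polar : ball_mass w (radius N b) =
  \int[lebesgue_measure]_(s in `]0, b]) h s.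
Proof.
rewrite /ball_mass /Rintegral -/(@eball R N (radius N b)) intF.
congr fine; apply: ae_eq_integral => //.
- exact: measurable_int iF.
- exact: measurable_int integrable_sphere_integral.
- have mb : measurable (`]0, b]%classic : set (measurableTypeR R)) by [].
  have := integrable_ae mb iF; apply: filterS.
  by move=> s /= Fs sb; rewrite hE// fineK// Fs.
Qed.

End ball_mass_polar.

(** * Integration of equivalent functions *)

Section asymptotic_integration.
Context (R : realType).
Local Notation mu := (@lebesgue_measure R).

Lemma integral_derivative (k K : R -> R) (a b : R) : a < b ->
  {in `[a, b], forall x : R, {for x, continuous k}} ->
  {in `[a, b], forall x : R, is_derive x (1 : R) K (k x)} ->
  (\int[mu]_(x in `]a, b]) (k x)%:E = (K b - K a)%:E)%E.
Proof.
move=> ab ck dK.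
have cwk : {within `[a, b], continuous k}.
  by apply/continuous_in_subspaceT => x; rewrite inE => /ck.
have cK x : x \in `[a, b] -> {for x, continuous K}.
  move=> xab; apply/differentiable_continuous; apply/derivable1_diffP.
  by have [] := dK _ xab.
rewrite integral_itv_obnd_cbnd; last first.
  apply: (@measurable_funS _ _ _ _ `[a, b]%classic) => //.
    by apply: subset_itvr; rewrite bnd_simp.
  by apply/measurable_EFinP; exact: subspace_continuous_measurable_fun.
rewrite (continuous_FTC2 ab cwk (F := K)).
- by rewrite EFinB.
- split.
  + by move=> x /subset_itv_oo_cc/dK [].
  + by apply: cvg_at_right_filter; apply: cK; rewrite in_itv/= lexx ltW.
  + by apply: cvg_at_left_filter; apply: cK; rewrite in_itv/= lexx ltW.
- by move=> x /subset_itv_oo_cc/dK [dKx <-]; rewrite derive1E.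
Qed.

(** Beyond some s0 the difference h - k is at most (e/2) k, so the integral of h
differs from K by a constant plus (e/2) K, and K dominates the constant. *)
Lemma asymp_integral (h k K : R -> R) :
  (forall x : R, 0 < x -> mu.-integrable `]0, x] (EFin \o h)) ->
  (forall x : R, 0 < x -> 0 < k x) ->
  (forall x : R, 0 < x -> {for x, continuous k}) ->
  (forall x : R, 0 < x -> is_derive x (1 : R) K (k x)) ->
  K x @[x --> +oo] --> +oo ->
  h x / k x @[x --> +oo] --> (1 : R) ->
  (\int[mu]_(s in `]0, x]) h s) / K x @[x --> +oo] --> (1 : R).
Proof.
move=> ih k0 ck dK Koo hk.
apply/cvgrPdist_le => e e0.
have e20 : 0 < e / 2 by rewrite divr_gt0.
have [s0 [s0_gt0 hs0 Ks0]] : exists s0 : R, [/\ 0 < s0,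
    forall s : R, s0 <= s -> `|h s - k s| <= e / 2 * k s & 0 <= K s0].
  have : \forall s \near +oo, 0 < s /\ `|1 - h s / k s| <= e / 2 /\ 0 <= K s.
    near=> s; split; first by near: s; exact: nbhs_pinfty_gt.
    split; first by near: s; move/cvgrPdist_le : hk; exact.
    by near: s; move/cvgryPge : Koo; exact.
  case=> M [Mr HM]; exists (M + 1); split.
  - by have [] := HM (M + 1) ltac:(by rewrite ltrDl).
  - move=> s Ms; have [s0 [+ _]] := HM s ltac:(by rewrite (lt_le_trans _ Ms)// ltrDl).
    have ks := k0 _ s0.
    rewrite -(ler_pM2r ks) -[X in _ * X <= _](gtr0_norm ks) -normrM mulrBl mul1r.
    by rewrite divfK ?gt_eqF// distrC.
  - by have [_ []] := HM (M + 1) ltac:(by rewrite ltrDl).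
pose G x := \int[mu]_(s in `]0, x]) h s.
pose C := `|G s0 - K s0|.
have main (x : R) : s0 < x -> `|G x - K x| <= C + e / 2 * K x.
  move=> s0x; have x0 : 0 < x := lt_trans s0_gt0 s0x.
  have sub : `]s0, x]%classic `<=` (`]0, x]%classic : set R).
    by apply: subset_itvr; rewrite bnd_simp ltW.
  have ihs : mu.-integrable `]s0, x] (EFin \o h).
    by apply: integrableS (ih _ x0).
  have ksx : (\int[mu]_(s in `]s0, x]) (k s)%:E = (K x - K s0)%:E)%E.
    apply: integral_derivative => // s; rewrite in_itv/= => /andP[s0s _].
      by apply: ck; exact: lt_le_trans s0s.
    by apply: dK; exact: lt_le_trans s0s.
  have mk : measurable_fun (`]s0, x]%classic : set R) k.
    have mk0 : measurable_fun (`]0, +oo[%classic : set R) k.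
      apply: open_continuous_measurable_fun; first exact: interval_open.
      by move=> s; rewrite inE/= in_itv/= andbT => /ck.
    apply: measurable_funS mk0 => // s /=.
    by rewrite !in_itv/= andbT => /andP[+ _]; exact: lt_trans.
  have iks : mu.-integrable `]s0, x] (EFin \o k).
    apply/integrableP; split; first exact/measurable_EFinP.
    rewrite [ltLHS](_ : _ = (K x - K s0)%:E) ?ltry//.
    rewrite -ksx; apply: eq_integral => s; rewrite inE/= in_itv/= => /andP[ss0 _].
    by rewrite /= gtr0_norm// k0// (lt_trans s0_gt0).
  have GE : G x = G s0 + \int[mu]_(s in `]s0, x]) h s.
    rewrite /G -Rintegral_setU//=.
    - by rewrite -itv_bndbnd_setU// bnd_simp ltW.
    - by rewrite -itv_bndbnd_setU ?bnd_simp ?ltW//; exact: ih.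
    - apply/disj_setPS => s [/=]; rewrite !in_itv/= => /andP[_ ss0] /andP[+ _].
      by rewrite ltNge ss0.
  have KE : K x - K s0 = \int[mu]_(s in `]s0, x]) k s by rewrite /Rintegral ksx.
  have Hd : `|\int[mu]_(s in `]s0, x]) h s - (K x - K s0)| <= e / 2 * (K x - K s0).
    rewrite KE -RintegralB// -RintegralZl//.
    apply: le_trans.
      apply: le_normr_Rintegral => //.
      exact: (integrableB _ ihs iks).
    apply: le_Rintegral => //.
    - apply: integrable_norm; exact: (integrableB _ ihs iks).
    - exact: (integrableZl _ (e / 2) iks).
    - by move=> s; rewrite /= in_itv/= => /andP[s0s _]; apply: hs0; exact: ltW.
  rewrite (_ : G x - K x = (G s0 - K s0) +
     (\int[mu]_(s in `]s0, x]) h s - (K x - K s0))); last by rewrite GE; ring.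
  apply: (le_trans (ler_normD _ _)); apply: lerD => //.
  apply: (le_trans Hd); rewrite ler_pM2l// lerBlDr lerDl//.
near=> x.
have xs0 : s0 < x by near: x; apply: nbhs_pinfty_gt; exact: num_real.
have KC : 2 * C / e + 1 <= K x by near: x; move/cvgryPge : Koo; exact.
have C0 : 0 <= C by exact: normr_ge0.
have Kx : 0 < K x.
  by apply: lt_le_trans KC; rewrite ltr_wpDl// divr_ge0 ?mulr_ge0// ltW.
rewrite -/(G x) -(ler_pM2r Kx) -[X in _ * X <= _](gtr0_norm Kx) -normrM.
rewrite mulrBl mul1r divfK ?gt_eqF// distrC.
apply: (le_trans (main _ xs0)).
have : 2 * C / e <= K x by apply: le_trans KC; rewrite lerDl.
rewrite ler_pdivrMr// => H.
rewrite [leRHS](_ : _ = K x * e / 2 + e / 2 * K x); last by field.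
by rewrite lerD2r ler_pdivlMr// mulrC.
Unshelve. all: by end_near. Qed.

End asymptotic_integration.

(** * Regular variation *)

Section regular_variation_lemmas.
Context (R : realType).
Implicit Types (U V : R -> R).

Lemma cvg_comp_scale U (l : R) (x : R) : 0 < x ->
  U t @[t --> +oo] --> l -> U (t * x) @[t --> +oo] --> l.
Proof.
move=> x0 Ul; apply: (@cvg_comp _ _ _ (fun t => t * x) U _ _ _ _ Ul).
by apply: gt0_cvgMly => //; exact: cvg_id.
Qed.

(** V(t x) / V(t) is the product of V(t x) / U(t x), U(t x) / U(t) and
U(t) / V(t), and the outer factors tend to 1. *)
Lemma RV_asymp_equiv (rho : R) V U : measurable_fun setT V ->
  asymp_equiv V U -> (\forall t \near +oo, 0 < U t) ->
  (forall x, 0 < x -> U (t * x) / U t @[t --> +oo] --> x `^ rho) ->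
  RV rho V.
Proof.
move=> mV VU U0 Urho.
have near0 : \forall t \near +oo, 0 < U t /\ 0 < V t.
  have VU0 : \forall t \near +oo, 0 < V t / U t.
    exact: (cvgr_gt _ (VU : _ --> _) _ ltr01).
  near=> t.
  have Ut : 0 < U t by near: t.
  split=> //; have : 0 < V t / U t by near: t.
  by rewrite pmulr_lgt0// invr_gt0.
have [M [Mr HM]] := near0.
exists (Num.max (M + 1) 1); split.
- by rewrite lt_max ltr01 orbT.
- exact: measurable_funS mV.
- move=> t; rewrite ge_max => /andP[Mt _].
  by have [] := HM t ltac:(by rewrite (lt_le_trans _ Mt)// ltrDl).
- move=> x x0.
  have E : \forall t \near +oo,
    (V (t * x) / U (t * x)) * (U (t * x) / U t) * (V t / U t)^-1 =
    V (t * x) / V t.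
    near=> t.
    have [Ut Vt] : 0 < U t /\ 0 < V t by near: t.
    have [Utx Vtx] : 0 < U (t * x) /\ 0 < V (t * x).
      apply: HM; rewrite -ltr_pdivrMr//; near: t.
      by apply: nbhs_pinfty_gt; exact: num_real.
    by field; rewrite !gt_eqF.
  apply: (cvg_trans (near_eq_cvg E)).
  rewrite -[x `^ rho]mul1r -[1 * _]mulr1; apply: cvgM.
    by apply: cvgM; [exact: (cvg_comp_scale x0 VU)|exact: Urho].
  by rewrite -[X in _ --> X]invr1; apply: cvgV => //; exact: oner_neq0.
Unshelve. all: by end_near. Qed.

Lemma RV_cvg V (l : R) : measurable_fun setT V -> 0 < l ->
  V t @[t --> +oo] --> l -> RV 0 V.
Proof.
move=> mV l0 Vl; apply: (@RV_asymp_equiv _ _ (fun=> l)) => //.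
- rewrite /asymp_equiv -[X in _ --> X](@divff _ l) ?gt_eqF//.
  by apply: cvgM => //; exact: cvg_cst.
- by near=> t.
- by move=> x x0; rewrite divff ?gt_eqF// powRr0; exact: cvg_cst.
Unshelve. all: by end_near. Qed.

Lemma RV0_factor V : RV 0 V -> RV_with_factor 0 V V.
Proof. by move=> V0; split=> //; near=> t; rewrite powRr0 mul1r.
Unshelve. all: by end_near. Qed.

Lemma RV_power V (C gamma : R) : measurable_fun setT V -> 0 < C ->
  asymp_equiv V (fun t => C * t `^ gamma) ->
  RV_with_factor gamma V (fun t => t `^ (- gamma) * V t) /\
  (t `^ (- gamma) * V t @[t --> +oo] --> C).
Proof.
move=> mV C0 VC.
have lim : t `^ (- gamma) * V t @[t --> +oo] --> C.
  rewrite -[X in _ --> X]mulr1.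
  have E : \forall t \near +oo,
    C * (V t / (C * t `^ gamma)) = t `^ (- gamma) * V t.
    near=> t.
    have t0 : 0 < t by near: t; exact: nbhs_pinfty_gt.
    have tg : 0 < t `^ gamma by rewrite powR_gt0.
    by rewrite powRN; field; rewrite !gt_eqF.
  apply: (cvg_trans (near_eq_cvg E)).
  by apply: cvgM => //; exact: cvg_cst.
split=> //; split.
- apply: (RV_asymp_equiv mV VC).
    near=> t; rewrite mulr_gt0// powR_gt0//; near: t; exact: nbhs_pinfty_gt.
  move=> x x0.
  have E : \forall t \near +oo, x `^ gamma =
     (C * (t * x) `^ gamma) / (C * t `^ gamma).
    near=> t.
    have t0 : 0 < t by near: t; exact: nbhs_pinfty_gt.
    have tg : 0 < t `^ gamma by rewrite powR_gt0.
    by rewrite powRM ?ltW//; field; rewrite !gt_eqF.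
  by apply: (cvg_trans (near_eq_cvg E)); exact: cvg_cst.
- apply: RV_cvg C0 lim.
  by apply: measurable_funM => //; exact: measurable_powR.
- near=> t.
  have t0 : 0 < t by near: t; exact: nbhs_pinfty_gt.
  have tg : 0 < t `^ gamma by rewrite powR_gt0.
  by rewrite powRN mulrA divff ?mul1r// gt_eqF.
Unshelve. all: by end_near. Qed.

Lemma cvg_powR_pinfty (a : R) : 0 < a -> t `^ a @[t --> +oo] --> (+oo : set_system R).
Proof.
move=> a0; apply/cvgryPge => A; near=> t.
apply: (@le_trans _ _ (Num.max A 0)); first by rewrite le_max lexx.
have m0 : 0 <= Num.max A 0 by rewrite le_max lexx orbT.
rewrite -[leLHS](powRr1 m0) -[X in _ `^ X](@mulVf _ a) ?gt_eqF// powRrM.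
have tA : Num.max A 0 `^ a^-1 <= t.
  by near: t; apply: nbhs_pinfty_ge; exact: num_real.
by apply: ge0_ler_powR => //; rewrite ?nnegrE ?powR_ge0 ?ltW// (le_trans _ tA)// powR_ge0.
Unshelve. all: by end_near. Qed.

Lemma cvg_ln_pinfty : ln t @[t --> +oo] --> (+oo : set_system R).
Proof.
apply/cvgryPge => A; near=> t.
have t0 : 0 < t by near: t; exact: nbhs_pinfty_gt.
rewrite -(expRK A) ler_ln ?posrE ?expR_gt0//.
Unshelve. all: by end_near. Qed.

(** ln (t x) / ln t = 1 + ln x / ln t tends to 1. *)
Lemma RV_log V (C : R) : measurable_fun setT V -> 0 < C ->
  asymp_equiv V (fun t => C * ln t) ->
  RV 0 V /\ (V t @[t --> +oo] --> +oo).
Proof.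
move=> mV C0 VC.
have lnoo := cvg_ln_pinfty.
have ln0 : \forall t \near +oo, 0 < ln t :> R by move/cvgryPgt : lnoo; exact.
split.
  apply: (RV_asymp_equiv mV VC).
    by near=> t; rewrite mulr_gt0//; near: t.
  move=> x x0; rewrite powRr0.
  have E : \forall t \near +oo, 1 + ln x * (ln t)^-1 =
     (C * ln (t * x)) / (C * ln t).
    near=> t.
    have t0 : 0 < t by near: t; exact: nbhs_pinfty_gt.
    have lt0 : 0 < ln t by near: t.
    by rewrite lnM ?posrE//; field; rewrite !gt_eqF.
  apply: (cvg_trans (near_eq_cvg E)).
  have H : 1 + ln x * (ln t)^-1 @[t --> +oo] --> (1 + ln x * 0 : R).
    apply: cvgD; first exact: cvg_cst.
    by apply: cvgM; [exact: cvg_cst|apply/gtr0_cvgV0].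
  by rewrite mulr0 addr0 in H.
have VC2 : \forall t \near +oo, 2^-1 < V t / (C * ln t).
  by apply: (cvgr_gt _ (VC : _ --> _)); rewrite invf_lt1 ?ltr1n.
apply/cvgryPge => A; near=> t.
have lt0 : 0 < ln t by near: t.
have : 2^-1 < V t / (C * ln t) by near: t.
rewrite ltr_pdivlMr ?mulr_gt0// => /ltW; apply: le_trans.
rewrite mulrA -ler_pdivrMl ?mulr_gt0//.
by near: t; move/cvgryPge : lnoo; exact.
Unshelve. all: by end_near. Qed.

End regular_variation_lemmas.

(** * Growth of the ball mass *)

Section ball_mass.
Context (R : realType) (N : nat) (N0 : (0 < N)%N).
Local Notation space := 'rV[R]_N.
Local Notation dx := (lebesgue_rV R N).
Variables (w : space -> R) (hw : L1loc w).
Hypothesis w_ge0 : {ae dx, forall x, 0 <= w x}.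

Let mw : measurable_fun setT w. Proof. by case: hw. Qed.

(** The positive part of w coincides with w almost everywhere and is nonnegative
   everywhere, as the monotone convergence theorem requires. *)
Let wp x := Num.max (w x) 0.

Let wp_ge0 x : (0 <= (wp x)%:E)%E. Proof. by rewrite lee_fin le_max lexx orbT. Qed.

Let mwp : measurable_fun setT (EFin \o wp).
Proof. by apply/measurable_EFinP; exact: measurable_maxr. Qed.

Let mEw : measurable_fun setT (EFin \o w).
Proof. exact/measurable_EFinP. Qed.

Lemma L1loc_integrable_eball r : dx.-integrable (@eball R N r) (EFin \o w).
Proof.
apply: integrableS (@eball_box R N r) _; [exact: measurable_box|exact: measurable_eball|].
by have [_] := hw; apply; exact: compact_box.
Qed.

Let w_wp (D : set space) : ae_eq dx D (EFin \o w) (EFin \o wp).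
Proof.
apply: filterS w_ge0 => x wx _ /=; congr (_%:E).
by rewrite /wp; apply/esym/max_idPl.
Qed.

Let intw_wp (D : set space) : measurable D ->
  (\int[dx]_(x in D) (w x)%:E = \int[dx]_(x in D) (wp x)%:E)%E.
Proof.
move=> mD; apply: ae_eq_integral => //.
- exact: measurable_funS mEw.
- exact: measurable_funS mwp.
Qed.

Lemma ball_massE r :
  (\int[dx]_(x in @eball R N r) (wp x)%:E = (ball_mass w r)%:E)%E.
Proof.
rewrite -intw_wp; last exact: measurable_eball.
rewrite /ball_mass /Rintegral fineK// integrable_fin_num//.
- exact: measurable_eball.
- exact: L1loc_integrable_eball.
Qed.

Lemma ball_mass_nondecreasing : nondecreasing_fun (ball_mass w).
Proof.
move=> r s rs; rewrite -lee_fin -!ball_massE; apply: ge0_subset_integral => //.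
- exact: measurable_eball.
- exact: measurable_eball.
- exact: measurable_funS mwp.
- by move=> x; rewrite /eball/= => /le_trans; exact.
Qed.

Lemma measurable_ball_mass : measurable_fun setT (ball_mass w).
Proof. by apply: nondecreasing_measurable => //; exact: ball_mass_nondecreasing. Qed.

Let cvg_ball_mass_nat :
  ((ball_mass w n%:R)%:E @[n --> \oo] --> \int[dx]_x (wp x)%:E)%E.
Proof.
have <- : \bigcup_n @eball R N n%:R = setT.
  rewrite -subTset => x _; exists (Num.Def.archi_bound (enorm x)) => //=.
  by rewrite /eball/= ltW// archi_boundP// enorm_ge0.
under eq_cvg do rewrite -ball_massE.
apply: ge0_nondecreasing_set_cvg_integral => //.
- move=> n m nm; rewrite subsetEset => x; rewrite /eball/= => /le_trans; apply.
  by rewrite ler_nat.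
- by move=> n; exact: measurable_eball.
- by move=> n; exact: measurable_funS mwp.
Qed.

(** Along the integers, the ball masses increase to the integral of w by monotone
convergence; monotonicity of the ball mass gives the limit along the reals. *)
Lemma ball_mass_cvg_integrable (M : R) : ball_mass w r @[r --> +oo] --> M <->
  dx.-integrable setT (EFin \o w) /\ \int[dx]_x w x = M.
Proof.
have natoo : (n%:R : R) @[n --> \oo] --> +oo by exact: cvgr_idn.
split=> [FM|[iw wM]].
  have IM : (\int[dx]_x (wp x)%:E = M%:E)%E.
    apply: cvg_unique cvg_ball_mass_nat _ => //.
    by apply: cvg_EFin; [exact: nearW|exact: cvg_comp natoo FM].
  split; last by rewrite /Rintegral intw_wp// IM.
  apply/integrableP; split => //.
  rewrite (_ : (\int[_]_(x in _) _)%E = M%:E) ?ltry//.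
  rewrite -IM; apply: ae_eq_integral => //.
    exact: measurableT_comp.
  apply: filterS w_ge0 => x wx _ /=; congr (_%:E).
  by rewrite ger0_norm// /wp; apply/esym/max_idPl.
have IM : (\int[dx]_x (wp x)%:E = M%:E)%E.
  by rewrite -intw_wp// -wM /Rintegral fineK// integrable_fin_num.
have FM r : ball_mass w r <= M.
  rewrite -lee_fin -IM -ball_massE; apply: ge0_subset_integral => //.
  exact: measurable_eball.
have Fsup := nondecreasing_cvgr ball_mass_nondecreasing
  (ltac:(by exists M => _ [r _ <-]; exact: FM)).
suff <- : sup (range (ball_mass w)) = M by [].
apply: (@cvg_unique _ _ (ball_mass w n%:R @[n --> \oo])) => //.
  exact: cvg_comp natoo Fsup.
by move: cvg_ball_mass_nat; rewrite IM => /fine_cvgP[].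
Qed.

(** The cone over the whole sphere, cut at radius 1, is the unit ball without its
centre. *)
Lemma sphere_area_gt0 : 0 < sphere_area R N.
Proof.
rewrite fine_gt0//; apply/andP; split; last first.
  apply: le_lt_trans (@surface_measureT_lty R N).
  by apply: le_measure; rewrite ?inE//; exact: measurable_esphere.
rewrite /surface_measure mule_gt0// ?lte_fin ?ltr0n//.
rewrite (_ : _ `&` _ = @eball R N 1 `\` [set 0]); last first.
  apply/seteqP; split => x; rewrite /eball/= /punctured_ball/=.
    move=> [_ /andP[x0 x1]]; split => // xE; move: x0.
    by rewrite xE /enorm big1 ?sqrtr0 ?ltxx// => i _; rewrite mxE expr0n.
  move=> [x1 /eqP x0].
  have ex0 : 0 < enorm x.
    by rewrite lt_def enorm_ge0 andbT; apply: contra x0 => /eqP/enorm_eq0 ->.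
  split; last by rewrite ex0.
  rewrite /esphere/= /direction enormZ ?invr_ge0 ?enorm_ge0//.
  by rewrite mulVf// gt_eqF.
have m0 := @measurable_origin R N.
have m1 := @measurable_eball R N 1.
apply: lt_le_trans (lebesgue_rV_eball_gt0 N0 (@ltr01 R)) _.
have : (dx (@eball R N 1) <=
    dx ((@eball R N 1 `\` [set 0%R]) `|` [set 0%R : space]))%E.
  apply: le_measure; rewrite ?inE//.
    by apply: measurableU => //; exact: measurableD.
  by move=> x x1; have [->|/eqP x0] := eqVneq x 0; [right|left].
move=> /le_trans; apply; rewrite (le_trans (measureU2 _ _ _))//.
  exact: measurableD.
by rewrite [X in (_ + X)%E](lebesgue_rV_origin R N0) adde0.
Qed.

Let radius_pow (r : R) : 0 <= r -> radius N (r ^+ N / N%:R) = r :> R.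
Proof.
move=> r0; have NR : N%:R != 0 :> R by rewrite pnatr_eq0 -lt0n.
rewrite /radius mulrCA divff// mulr1.
by rewrite -powR_mulrn// -powRrM divff// powRr1.
Qed.

(** The asymptotics of the ball mass in the variable s = r^N / N: a density k
equivalent to the sphere integrals of w, with primitive K. *)
Lemma ball_mass_asymp (k K : R -> R) :
  (forall x : R, 0 < x -> 0 < k x) ->
  (forall x : R, 0 < x -> {for x, continuous k}) ->
  (forall x : R, 0 < x -> is_derive x (1 : R) K (k x)) ->
  K x @[x --> +oo] --> +oo ->
  sphere_area R N * spherical_mean w (radius N s) / k s @[s --> +oo] --> (1 : R) ->
  ball_mass w r / K (r ^+ N / N%:R) @[r --> +oo] --> (1 : R).
Proof.
move=> k0 ck dK Koo hk.
pose h s := \int[@surface_measure R N]_(theta in @esphere R N)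
  w (radius N s *: theta).
have hE s : sphere_area R N * spherical_mean w (radius N s) = h s.
  by rewrite /spherical_mean mulrA divff ?mul1r// gt_eqF// sphere_area_gt0.
have A := @asymp_integral R h k K _ k0 ck dK Koo _.
have {}A : (\int[lebesgue_measure]_(s in `]0, x]) h s) / K x @[x --> +oo] --> (1 : R).
  apply: A.
    move=> x x0; apply: integrable_sphere_integral => //.
    exact: L1loc_integrable_eball.
  by under eq_cvg do rewrite -hE.
have boo : r ^+ N / N%:R @[r --> +oo] --> (+oo : set_system R).
  apply/cvgryPge => B; near=> r.
  have r1 : 1 <= r by near: r; exact: nbhs_pinfty_ge.
  rewrite ler_pdivlMr ?ltr0n//; apply: (@le_trans _ _ r).
    by near: r; apply: nbhs_pinfty_ge; exact: num_real.
  by rewrite -[leLHS]expr1; apply: ler_weXn2l.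
have E : \forall r \near +oo,
  (\int[lebesgue_measure]_(s in `]0, r ^+ N / N%:R]) h s) / K (r ^+ N / N%:R) =
  ball_mass w r / K (r ^+ N / N%:R).
  near=> r; congr (_ / _).
  have r0 : 0 < r by near: r; exact: nbhs_pinfty_gt.
  rewrite -[in RHS](radius_pow (ltW r0)) ball_mass_polar//.
    by rewrite divr_gt0 ?exprn_gt0// ltr0n.
  exact: L1loc_integrable_eball.
apply: (cvg_trans (near_eq_cvg E)).
exact: (cvg_comp _ _ boo A).
Unshelve. all: by end_near. Qed.

Let NR : 0 < N%:R :> R. Proof. by rewrite ltr0n. Qed.

Let Noo : N%:R * s @[s --> +oo] --> (+oo : set_system R).
Proof. by apply: gt0_cvgMry => //; exact: cvg_id. Qed.

Let radius_oo : radius N s @[s --> +oo] --> (+oo : set_system R).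
Proof.
apply: (@cvg_comp _ _ _ (fun s => N%:R * s) (@powR R ^~ N%:R^-1) _ _ _ Noo).
by apply: cvg_powR_pinfty; rewrite invr_gt0.
Qed.

Let is_derive_powRN (a s : R) : 0 < s ->
  is_derive s (1 : R) (fun s => (N%:R * s) `^ a) (N%:R * (a * (N%:R * s) `^ (a - 1))).
Proof.
move=> s0; have Ns : 0 < N%:R * s by rewrite mulr_gt0.
have d1 : is_derive s (1 : R) ( *%R N%:R : R -> R) (N%:R : R).
  by apply: is_derive_eq; rewrite /GRing.scale/= mulr1.
have := @is_derive1_comp R (@powR R ^~ a) (fun s => N%:R * s) s _ _
  (is_derive1_powR a Ns) d1.
by move=> H; apply: is_derive_eq; rewrite mulrC.
Qed.

Let continuous_powRN (a s : R) : 0 < s ->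
  {for s, continuous (fun s : R => (N%:R * s) `^ a)}.
Proof.
move=> s0; apply/differentiable_continuous; apply/derivable1_diffP.
by have [] := is_derive_powRN a s0.
Qed.

Lemma ball_mass_asymp_power (gamma c : R) : 0 < gamma -> 0 < c ->
  asymp_equiv (spherical_mean w) (fun r => c * r `^ (- (N%:R - gamma))) ->
  asymp_equiv (ball_mass w) (fun r => c * sphere_area R N / gamma * r `^ gamma).
Proof.
move=> g0 c0 wc; have S0 := sphere_area_gt0.
pose C := c * sphere_area R N.
have C0 : 0 < C by rewrite mulr_gt0.
(* With r = (N s)^(1/N), the density c r^-(N - gamma) is c (N s)^(a - 1) for
   a = gamma / N, and its primitive is c (N s)^a / gamma. *)
pose a := gamma / N%:R.
have a0 : 0 < a by rewrite divr_gt0.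
have aN : gamma = a * N%:R by rewrite divfK ?gt_eqF.
have H := @ball_mass_asymp (fun s => C * (N%:R * s) `^ (a - 1))
  (fun s => C / gamma * (N%:R * s) `^ a) _ _ _ _ _.
have {}H : ball_mass w r / (C / gamma * (N%:R * (r ^+ N / N%:R)) `^ a)
    @[r --> +oo] --> (1 : R).
  apply: H.
  - by move=> s s0; rewrite mulr_gt0// powR_gt0// mulr_gt0.
  - move=> s s0; apply: continuousM; first exact: cst_continuous.
    exact: continuous_powRN.
  - move=> s s0.
    have d := is_derive_powRN a s0.
    apply: is_derive_eq; rewrite /GRing.scale/= aN.
    by field; rewrite !gt_eqF.
  - apply: gt0_cvgMry; first by rewrite divr_gt0.
    exact: (cvg_comp _ _ Noo (cvg_powR_pinfty a0)).
  - have E : \forall s \near +oo,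
      spherical_mean w (radius N s) / (c * radius N s `^ (- (N%:R - gamma))) =
      sphere_area R N * spherical_mean w (radius N s) / (C * (N%:R * s) `^ (a - 1)).
      near=> s.
      have s0 : 0 < s by near: s; exact: nbhs_pinfty_gt.
      rewrite /radius -powRrM (_ : _ * - _ = a - 1); last first.
        by rewrite aN; field; rewrite gt_eqF.
      have p0 : 0 < (N%:R * s) `^ (a - 1) by rewrite powR_gt0// mulr_gt0.
      by rewrite /C; field; rewrite !gt_eqF.
    apply: (cvg_trans (near_eq_cvg E)).
    exact: (cvg_comp _ _ radius_oo (wc : _ --> _)).
apply: cvg_trans H; apply: near_eq_cvg; near=> r.
have r0 : 0 <= r by near: r; exact: nbhs_pinfty_ge.
rewrite mulrCA divff ?mulr1 ?gt_eqF// -powR_mulrn// -powRrM.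
by rewrite /a mulrCA divff ?mulr1 ?gt_eqF.
Unshelve. all: by end_near. Qed.

Lemma ball_mass_asymp_log (c : R) : 0 < c ->
  asymp_equiv (spherical_mean w) (fun r => c * r `^ (- N%:R)) ->
  asymp_equiv (ball_mass w) (fun r => c * sphere_area R N * ln r).
Proof.
move=> c0 wc; have S0 := sphere_area_gt0.
pose C := c * sphere_area R N.
have C0 : 0 < C by rewrite mulr_gt0.
(* With r = (N s)^(1/N), the density c r^-N is c / (N s), and its primitive is
   c ln (N s) / N. *)
have H := @ball_mass_asymp (fun s => C * (N%:R * s) `^ (-1))
  (fun s => C / N%:R * ln (N%:R * s)) _ _ _ _ _.
have {}H : ball_mass w r / (C / N%:R * ln (N%:R * (r ^+ N / N%:R)))
    @[r --> +oo] --> (1 : R).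
  apply: H.
  - by move=> s s0; rewrite mulr_gt0// powR_gt0// mulr_gt0.
  - move=> s s0; apply: continuousM; first exact: cst_continuous.
    exact: continuous_powRN.
  - move=> s s0; have Ns : 0 < N%:R * s by rewrite mulr_gt0.
    have d1 : is_derive s (1 : R) ( *%R N%:R : R -> R) (N%:R : R).
      by apply: is_derive_eq; rewrite /GRing.scale/= mulr1.
    have d := @is_derive1_comp R (@ln R) (fun s => N%:R * s) s _ _
      (is_derive1_ln Ns) d1.
    apply: is_derive_eq; rewrite /GRing.scale/=.
    rewrite powR_inv1 ?ltW//.
    by field; rewrite !gt_eqF.
  - apply: gt0_cvgMry; first by rewrite divr_gt0.
    exact: (cvg_comp _ _ Noo (@cvg_ln_pinfty R)).
  - have E : \forall s \near +oo,
      spherical_mean w (radius N s) / (c * radius N s `^ (- N%:R)) =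
      sphere_area R N * spherical_mean w (radius N s) / (C * (N%:R * s) `^ (-1)).
      near=> s.
      have s0 : 0 < s by near: s; exact: nbhs_pinfty_gt.
      rewrite /radius -powRrM mulrN mulVf ?gt_eqF//.
      have p0 : 0 < (N%:R * s) `^ (-1) by rewrite powR_gt0// mulr_gt0.
      by rewrite /C; field; rewrite !gt_eqF.
    apply: (cvg_trans (near_eq_cvg E)).
    exact: (cvg_comp _ _ radius_oo (wc : _ --> _)).
apply: cvg_trans H; apply: near_eq_cvg; near=> r.
have r0 : 0 < r by near: r; exact: nbhs_pinfty_gt.
rewrite mulrCA divff ?mulr1 ?gt_eqF// -powR_mulrn ?ltW// ln_powR.
by rewrite mulrA divfK ?gt_eqF.
Unshelve. all: by end_near. Qed.

End ball_mass.

(** * A compactly supported test function *)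

Section calculus.
Context (R : realType).

(** A directional derivative is the derivative at 0 of the restriction to a line;
this reduces the partial derivatives below to one-variable calculus. *)
Lemma is_derive_slice (V : normedModType R) (F : V -> R) (a v : V) (d : R) :
  is_derive (0 : R) (1 : R) (fun h : R => F (h *: v + a)) d -> is_derive a v F d.
Proof.
set G := fun h : R => F (h *: v + a).
have E : (fun h : R => h^-1 *: ((G \o shift (0 : R)) (h *: (1 : R)) - G 0)) =
         (fun h : R => h^-1 *: ((F \o shift a) (h *: v) - F a)).
  apply/funext => h; rewrite /G /= scale0r add0r addr0.
  by rewrite [h *: (1 : R)]mulr1.
by move=> [dG Gd]; split; [rewrite /derivable -E|rewrite -Gd /derive -E].
Qed.

(** The truncated power s_+^n, of class C^(n-1). *)
Definition pospow (n : nat) (s : R) : R := Num.max s 0 ^+ n.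

Lemma pospow_ge0 n s : 0 <= pospow n s.
Proof. by rewrite exprn_ge0// le_max lexx orbT. Qed.

Lemma max0_continuous : continuous (fun s : R => Num.max s 0).
Proof. by move=> s; apply: continuous_max; [exact: cvg_id|exact: cst_continuous]. Qed.

Lemma pospow_continuous n : continuous (pospow n).
Proof.
rewrite (_ : pospow n = (fun s : R => s ^+ n) \o (fun s : R => Num.max s 0))//.
move=> s; apply: continuous_comp; first exact: max0_continuous.
exact: exprn_continuous.
Qed.

(** Away from 0 the function is locally a power or constant; at 0 it is
z_+^(n+1) times z, with a continuous first factor. *)
Lemma is_derive_pospow n (s : R) :
  is_derive s (1 : R) (pospow n.+2) (n.+2%:R * pospow n.+1 s).
Proof.
have [s0|s0|s0] := ltgtP s 0.
- apply: (@near_eq_is_derive R R R (cst 0)).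
    near=> t; have t0 : t < 0 by near: t; exact: (cvgr_lt _ (@cvg_id _ (nbhs s)) _ s0).
    by rewrite /pospow max_r ?ltW// expr0n.
  rewrite /pospow max_r ?ltW// expr0n mulr0; exact: is_derive_cst.
- apply: (@near_eq_is_derive R R R (fun t : R => t ^+ n.+2)).
    near=> t; have t0 : 0 < t by near: t; exact: (cvgr_gt _ (@cvg_id _ (nbhs s)) _ s0).
    by rewrite /pospow max_l ?ltW.
  rewrite /pospow max_l ?ltW//.
  have := @is_deriveX _ _ id n.+2 s (1 : R) 1 (is_derive_id s (1 : R)).
  by rewrite [_ *: _]mulr1 exprfctE.
- apply/is_derive1_caratheodory; exists (pospow n.+1); split.
  + move=> z; rewrite s0 /pospow maxxx expr0n/= !subr0.
    by have [z0|z0] := leP z 0; rewrite ?expr0n/= ?mul0r// exprSr.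
  + exact: pospow_continuous.
  + by rewrite s0 /pospow maxxx expr0n mulr0.
Unshelve. all: by end_near. Qed.

End calculus.

Section test_function.
Context (R : realType) (N : nat) (T rho : R) (m : nat).
Hypotheses (T0 : 0 < T) (rho0 : 0 < rho).
Local Notation space := 'rV[R]_N.
Implicit Types (x : space) (z : R * space) (t : R).

Definition cutoff (n : nat) x : R := pospow n (1 - sumsq x / rho ^+ 2).

Definition ramp t : R := 1 - t / T.

(** The exponent m + 3 leaves X to the power m + 1 after two differentiations in
space, so that the second derivatives are continuous. *)
Definition bump z : R := ramp z.1 ^+ m.+3 * cutoff m.+3 z.2.

Definition bump_t z : R :=
  - (m.+3%:R / T) * ramp z.1 ^+ m.+2 * cutoff m.+3 z.2.

Definition bump_x (i : 'I_N) z : R :=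
  - (2 * m.+3%:R / rho ^+ 2) * ramp z.1 ^+ m.+3 *
  (cutoff m.+2 z.2 * z.2 ord0 i).

Definition bump_xx (i j : 'I_N) z : R :=
  - (2 * m.+3%:R / rho ^+ 2) * ramp z.1 ^+ m.+3 *
  (cutoff m.+2 z.2 * (i == j)%:R -
   2 * m.+2%:R / rho ^+ 2 * cutoff m.+1 z.2 * z.2 ord0 j * z.2 ord0 i).

(** Along a coordinate line the cutoff is a truncated power of a quadratic
polynomial. *)
Lemma sumsq_shift (i : 'I_N) x (h : R) :
  sumsq (h *: delta_mx ord0 i + x) = sumsq x + h * (2 * x ord0 i + h).
Proof.
rewrite /sumsq (bigD1 i)//= [in RHS](bigD1 i)//=.
rewrite (eq_bigr (fun j => x ord0 j ^+ 2)); last first.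
  by move=> j ji; rewrite !mxE eqxx (negbTE ji) mulr0 add0r.
by rewrite !mxE !eqxx mulr1; ring.
Qed.

Lemma is_derive_cutoff n (i : 'I_N) x :
  is_derive x (delta_mx ord0 i : space) (cutoff n.+2)
    (- (2 * n.+2%:R / rho ^+ 2) * (cutoff n.+1 x * x ord0 i)).
Proof.
apply: is_derive_slice.
pose g (h : R) := 1 - (sumsq x + h * (2 * x ord0 i + h)) / rho ^+ 2.
have dg : is_derive (0 : R) (1 : R) g (- (2 * x ord0 i) / rho ^+ 2).
  apply/is_derive1_caratheodory.
  exists (fun h => - (2 * x ord0 i + h) / rho ^+ 2); split.
  - by move=> z; rewrite /g; field; rewrite gt_eqF.
  - apply: cvgM; last exact: cvg_cst.
    by apply: cvgN; apply: cvgD; [exact: cvg_cst|exact: cvg_id].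
  - by rewrite addr0.
rewrite (_ : (fun h => _) = pospow n.+2 \o g); last first.
  by apply/funext => h; rewrite /cutoff sumsq_shift.
have := is_derive1_comp (is_derive_pospow n (g 0)) dg.
move=> H; apply: is_derive_eq.
rewrite /cutoff (_ : g 0 = 1 - sumsq x / rho ^+ 2); last first.
  by rewrite /g mul0r addr0.
by field; rewrite gt_eqF.
Qed.

Lemma is_derive_coord (i j : 'I_N) x :
  is_derive x (delta_mx ord0 j : space) (fun y : space => y ord0 i)
    ((i == j)%:R : R).
Proof.
apply: is_derive_slice; apply/is_derive1_caratheodory.
exists (cst (i == j)%:R); split; [|exact: cst_continuous|by []].
by move=> h; rewrite !mxE eqxx/=; ring.
Qed.

Lemma is_derive_bump_t z :
  is_derive z.1 (1 : R) (fun t => bump (t, z.2)) (bump_t z).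
Proof.
have dr : is_derive z.1 (1 : R) ramp (- T^-1).
  apply/is_derive1_caratheodory; exists (cst (- T^-1)); split => //.
    by move=> t; rewrite /ramp/=; field; rewrite gt_eqF.
  exact: cst_continuous.
rewrite (_ : (fun _ => _) = (ramp ^+ m.+3) * cst (cutoff m.+3 z.2)); last first.
  by apply/funext => t; rewrite /bump exprfctE.
apply: is_derive_eq; rewrite scaler0 add0r /bump_t /GRing.scale/=.
by field; rewrite gt_eqF.
Qed.

Lemma is_derive_bump_x i z :
  is_derive z.2 (delta_mx ord0 i : space) (fun x => bump (z.1, x)) (bump_x i z).
Proof.
rewrite (_ : (fun _ => _) = (ramp z.1 ^+ m.+3) \*: cutoff m.+3); last first.
  by apply/funext => x.
have d := is_derive_cutoff m.+1 i z.2.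
apply: is_derive_eq; rewrite /bump_x /GRing.scale/=.
by ring.
Qed.

Lemma is_derive_bump_xx i j z :
  is_derive z.2 (delta_mx ord0 j : space) (fun x => bump_x i (z.1, x))
    (bump_xx i j z).
Proof.
rewrite (_ : (fun _ => _) = (- (2 * m.+3%:R / rho ^+ 2) * ramp z.1 ^+ m.+3) \*:
   (cutoff m.+2 * (fun x : space => x ord0 i))); last by apply/funext => x.
have d1 := is_derive_cutoff m j z.2.
have d2 := is_derive_coord i j z.2.
apply: is_derive_eq; rewrite /bump_xx /GRing.scale/=.
by ring.
Qed.

Lemma time_deriv_bump : time_deriv bump = bump_t.
Proof.
apply/funext => z; rewrite /time_deriv derive1E.
by have [] := is_derive_bump_t z.
Qed.

Lemma space_deriv_bump i : space_deriv i bump = bump_x i.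
Proof. by apply/funext => z; have [] := is_derive_bump_x i z. Qed.

Lemma space_deriv_bump_x i j : space_deriv j (bump_x i) = bump_xx i j.
Proof. by apply/funext => z; have [] := is_derive_bump_xx i j z. Qed.

Lemma laplacian_bump z : laplacian bump z =
  - (2 * m.+3%:R / rho ^+ 2) * ramp z.1 ^+ m.+3 *
  (cutoff m.+2 z.2 * N%:R -
   2 * m.+2%:R / rho ^+ 2 * cutoff m.+1 z.2 * sumsq z.2).
Proof.
rewrite /laplacian.
under eq_bigr do rewrite space_deriv_bump space_deriv_bump_x /bump_xx eqxx mulr1.
rewrite -mulr_sumr; congr (_ * _).
rewrite big_split/= sumr_const card_ord; congr (_ + _).
  by rewrite mulr_natr.
by rewrite sumrN mulr_sumr; congr (- _); apply: eq_bigr => i _; rewrite expr2 mulrA.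
Qed.

Lemma continuous_ramp : continuous (fun z : R * space => ramp z.1).
Proof.
move=> z; apply: cvgB; first exact: cvg_cst.
by apply: cvgM; [exact: cvg_fst|exact: cvg_cst].
Qed.

Lemma continuous_rV_coord i : continuous (fun z : R * space => z.2 ord0 i).
Proof.
move=> z; apply: (@cvg_comp _ _ _ snd (fun x : space => x ord0 i)).
  exact: cvg_snd.
exact: coord_continuous.
Qed.

Lemma continuous_cutoff n : continuous (fun z : R * space => cutoff n z.2).
Proof.
move=> z; apply: (@cvg_comp _ _ _
  (fun z : R * space => 1 - sumsq z.2 / rho ^+ 2) (@pospow R n)); last first.
  exact: pospow_continuous.
apply: cvgB; first exact: cvg_cst.
apply: cvgM; last exact: cvg_cst.
rewrite /sumsq; apply: cvg_big => [|i _]; first exact: add_continuous.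
by apply: cvgM; exact: continuous_rV_coord.
Qed.

Lemma continuous_ramp_pow n : continuous (fun z : R * space => ramp z.1 ^+ n).
Proof.
move=> z; apply: (@cvg_comp _ _ _ (fun z : R * space => ramp z.1)
  (fun t => t ^+ n)); first exact: continuous_ramp.
exact: exprn_continuous.
Qed.

Lemma continuous_bump : continuous bump.
Proof.
by move=> z; apply: cvgM; [exact: continuous_ramp_pow|exact: continuous_cutoff].
Qed.

Lemma continuous_bump_t : continuous bump_t.
Proof.
move=> z; apply: cvgM; last exact: continuous_cutoff.
by apply: cvgM; [exact: cvg_cst|exact: continuous_ramp_pow].
Qed.

Lemma continuous_bump_x i : continuous (bump_x i).
Proof.
move=> z; apply: cvgM.
  by apply: cvgM; [exact: cvg_cst|exact: continuous_ramp_pow].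
by apply: cvgM; [exact: continuous_cutoff|exact: continuous_rV_coord].
Qed.

Lemma continuous_bump_xx i j : continuous (bump_xx i j).
Proof.
move=> z; apply: cvgM.
  by apply: cvgM; [exact: cvg_cst|exact: continuous_ramp_pow].
apply: cvgB.
  by apply: cvgM; [exact: continuous_cutoff|exact: cvg_cst].
apply: cvgM; last exact: continuous_rV_coord.
apply: cvgM; last exact: continuous_rV_coord.
by apply: cvgM; [exact: cvg_cst|exact: continuous_cutoff].
Qed.

Lemma ramp_ge0 t : t <= T -> 0 <= ramp t.
Proof. by move=> tT; rewrite subr_ge0 ler_pdivrMr// mul1r. Qed.

Lemma ramp_le1 t : 0 <= t -> ramp t <= 1.
Proof. by move=> t0; rewrite gerBl divr_ge0// ltW. Qed.

Lemma cutoff_ge0 n x : 0 <= cutoff n x.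
Proof. exact: pospow_ge0. Qed.

Lemma cutoff_box n x : ~ @box R N rho x -> cutoff n.+1 x = 0.
Proof.
move=> xb; rewrite /cutoff /pospow max_r ?expr0n//.
rewrite subr_le0 ler_pdivlMr ?exprn_gt0// mul1r.
have [i] : exists i, ~ (x ord0 i \in `[- rho, rho]).
  by apply/existsNP => h; apply: xb => i; exact: h.
rewrite in_itv/= -ler_norml => /negP; rewrite -ltNge => rx.
rewrite /sumsq -sqr_enorm ler_pXn2r// ?nnegrE ?enorm_ge0 ?(ltW rho0)//.
apply: ltW; exact: (lt_le_trans rx (ler_coord_enorm x i)).
Qed.

Lemma test_function_bump : test_function T bump.
Proof.
split.
- split.
  + exact/continuous_subspaceT/continuous_bump.
  + split; first by move=> z _; have [] := is_derive_bump_t z.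
    exists bump_t; first exact/continuous_subspaceT/continuous_bump_t.
    by move=> z _; rewrite time_deriv_bump.
  + move=> i; rewrite space_deriv_bump; split.
      by move=> z _; have [] := is_derive_bump_x i z.
    exact/continuous_subspaceT/continuous_bump_x.
  + move=> i; rewrite space_deriv_bump => j; rewrite space_deriv_bump_x; split.
      by move=> z _; have [] := is_derive_bump_xx i j z.
    exact/continuous_subspaceT/continuous_bump_xx.
- move=> z /andP[_ zT]; apply: mulr_ge0; last exact: cutoff_ge0.
  by apply: exprn_ge0; exact: ramp_ge0.
- exists (@box R N rho); first exact: compact_box.
  by move=> z _ zb; rewrite /bump cutoff_box// mulr0.
- by move=> x; rewrite /bump /ramp/= divff ?gt_eqF// subrr expr0n mul0r.
Qed.

End test_function.

(** * Absorption of the derivatives of the test function *)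

Section pointwise_bounds.
Context (R : realType).

Lemma young_absorb (p a d : R) : 1 < p -> 0 <= a -> 0 <= d ->
  a * d <= a `^ p + d `^ (p / (p - 1)).
Proof.
move=> p1 a0 d0; have p0 : 0 < p by exact: lt_trans p1.
have pm : 0 < p - 1 by rewrite subr_gt0.
apply: (le_trans (@conjugate_powR R a d p (p / (p - 1)) a0 d0 p0 _ _)).
- by rewrite divr_gt0.
- by rewrite invf_div; field; rewrite gt_eqF.
- apply: lerD; rewrite ler_pdivrMr ?divr_gt0// ler_peMr ?powR_ge0 ?ltW//.
  by rewrite ltr_pdivlMr// mul1r gtrBl.
Qed.

(** Powers of a number in [0, 1] decrease with the exponent; this is how a high
power of the test function absorbs the powers lost by differentiation. *)
Lemma powR_expn_le (p s : R) (a b : nat) : 0 <= s <= 1 ->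
  b.+1%:R <= p * a.+1%:R -> (s ^+ a.+1) `^ p <= s ^+ b.+1.
Proof.
move=> /andP[s0 s1] ab.
move: s0; rewrite le_eqVlt => /predU1P[<-|s0].
  rewrite !expr0n/= powR0// gt_eqF//.
  have : 0 < p * a.+1%:R by apply: lt_le_trans ab; rewrite ltr0n.
  by rewrite pmulr_lgt0// ltr0n.
have s01 : 0 < s <= 1 by rewrite s0.
rewrite -(powR_mulrn a.+1 (ltW s0)) -(powR_mulrn b.+1 (ltW s0)) -powRrM.
by apply: (ger_powR s01); rewrite mulrC.
Qed.

Context (N : nat) (T rho : R) (m : nat).
Hypotheses (T0 : 0 < T) (rho0 : 0 < rho).
Local Notation space := 'rV[R]_N.
Local Notation bump := (@bump R N T rho m).
Local Notation bump_t := (@bump_t R N T rho m).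

(** The function B with |phi_t| + |Delta phi| <= d B and B^p <= phi, where d is the
coefficient [decay]. *)
Definition weight (z : R * space) : R :=
  ramp T z.1 ^+ m.+2 * cutoff rho m.+1 z.2.

Definition decay : R :=
  m.+3%:R / T + 2 * m.+3%:R * (N%:R + 2 * m.+2%:R) / rho ^+ 2.

Let cut01 (x : space) : 0 <= Num.max (1 - sumsq x / rho ^+ 2) 0 <= 1.
Proof.
rewrite le_max lexx orbT ge_max ler01 andbT/= gerBl divr_ge0 ?sqr_ge0//.
exact: sumsq_ge0.
Qed.

Let cutS n (x : space) : cutoff rho n.+1 x <= cutoff rho n x.
Proof.
have /andP[c0 c1] := cut01 x.
by rewrite /cutoff /pospow exprS ler_piMl// exprn_ge0.
Qed.

(** The factor |x|^2 / rho^2 in the second derivatives is at most 1 on the support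
   of the cutoff. *)
Let cut_sumsq n (x : space) :
  cutoff rho n.+1 x * sumsq x <= cutoff rho n.+1 x * rho ^+ 2.
Proof.
have [Q1|Q1] := leP (sumsq x) (rho ^+ 2).
  by rewrite ler_wpM2l// cutoff_ge0.
rewrite /cutoff /pospow max_r ?expr0n ?mul0r//.
by rewrite subr_le0 ler_pdivlMr ?exprn_gt0// mul1r ltW.
Qed.

Let ramp01 t : 0 <= t <= T -> 0 <= ramp T t <= 1.
Proof. by move=> /andP[t0 tT]; rewrite ramp_ge0// ramp_le1. Qed.

Lemma weight_ge0 z : 0 <= z.1 <= T -> 0 <= weight z.
Proof.
move=> /ramp01/andP[r0 _]; apply: mulr_ge0; last exact: cutoff_ge0.
exact: exprn_ge0.
Qed.

Lemma bump_t_le z : 0 <= z.1 <= T -> `|bump_t z| <= m.+3%:R / T * weight z.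
Proof.
move=> /ramp01/andP[r0 _]; rewrite /bump_t /weight mulNr mulNr normrN -mulrA.
have c3 := @cutoff_ge0 R N rho m.+3 z.2.
rewrite ger0_norm; last first.
  by apply: mulr_ge0; [rewrite divr_ge0// ltW|rewrite mulr_ge0// exprn_ge0].
rewrite ler_wpM2l ?divr_ge0 ?(ltW T0)//.
rewrite ler_wpM2l ?exprn_ge0//.
by rewrite (le_trans (cutS _ _))// cutS.
Qed.

Lemma laplacian_bump_le z : 0 <= z.1 <= T -> `|laplacian bump z| <=
  2 * m.+3%:R * (N%:R + 2 * m.+2%:R) / rho ^+ 2 * weight z.
Proof.
move=> /ramp01/andP[r0 r1]; rewrite laplacian_bump// /weight.
have rn0 := exprn_ge0 m.+2 r0.
have rho2 : 0 < rho ^+ 2 by rewrite exprn_gt0.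
have c1 := @cutoff_ge0 R N rho m.+1 z.2.
have c2 := @cutoff_ge0 R N rho m.+2 z.2.
have c21 := cutS m.+1 z.2.
have sc := cut_sumsq m z.2.
have s0 : 0 <= sumsq z.2 by exact: sumsq_ge0.
rewrite [ramp T z.1 ^+ m.+3]exprS.
move: (ramp T z.1 ^+ m.+2) rn0 => Y Y0.
move: (cutoff rho m.+1 z.2) (cutoff rho m.+2 z.2) (sumsq z.2) c1 c2 c21 sc s0.
move=> c c' Q c0 c'0 c'c cQ Q0.
rewrite -mulrA normrM normrN.
rewrite (ger0_norm (x := 2 * m.+3%:R / rho ^+ 2)); last first.
  by rewrite divr_ge0 ?sqr_ge0.
rewrite [leRHS](_ : _ = 2 * m.+3%:R / rho ^+ 2 *
  (Y * (c * N%:R + 2 * m.+2%:R * c))); last by field; rewrite gt_eqF.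
rewrite ler_wpM2l ?divr_ge0 ?sqr_ge0// normrM.
rewrite ler_pM//.
  by rewrite ger0_norm ?mulr_ge0// ler_piMl.
apply: (le_trans (ler_normB _ _)).
have H0 : 0 <= 2 * m.+2%:R / rho ^+ 2 * c * Q.
  by rewrite !mulr_ge0// invr_ge0 sqr_ge0.
rewrite (ger0_norm H0) ger0_norm ?mulr_ge0//; apply: lerD.
  by rewrite ler_wpM2r.
rewrite [leLHS](_ : _ = 2 * m.+2%:R * (c * Q / rho ^+ 2)); last by field; rewrite gt_eqF.
by rewrite ler_wpM2l// ler_pdivrMr.
Qed.

Lemma weight_powR_le (p : R) z : m.+3%:R <= p * m.+1%:R -> 0 <= z.1 <= T ->
  weight z `^ p <= bump z.
Proof.
move=> mp zT; have /andP[r0 r1] := ramp01 zT.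
have p0 : 0 <= p.
  have : 0 < p * m.+1%:R by apply: lt_le_trans mp; rewrite ltr0n.
  by rewrite pmulr_lgt0 ?ltr0n// => /ltW.
have w1 : 0 <= ramp T z.1 ^+ m.+2 by exact: exprn_ge0.
rewrite /weight (powRM p w1 (cutoff_ge0 _ _ _)).
apply: ler_pM; rewrite ?powR_ge0//.
  apply: powR_expn_le; first by rewrite r0.
  by apply: (le_trans mp); rewrite ler_wpM2l// ler_nat.
by apply: powR_expn_le.
Qed.

(** The part |u|^p phi of the bound is exactly the reaction term of the equation
tested against phi. *)
Lemma bump_absorb (p a : R) z : 1 < p -> m.+3%:R <= p * m.+1%:R ->
  0 <= z.1 <= T ->
  `|a * bump_t z| + `|a * laplacian bump z| <=
  `|a| `^ p * bump z + decay `^ (p / (p - 1)).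
Proof.
move=> p1 mp zT; rewrite (normrM a) (normrM a) -(mulrDr `|a|).
have w0 := weight_ge0 zT.
have d0 : 0 <= decay.
  by apply: addr_ge0; apply: divr_ge0; rewrite ?sqr_ge0 ?(ltW T0).
apply: (@le_trans _ _ (`|a| * weight z * decay)).
  rewrite -[leRHS]mulrA (mulrC (weight z)); apply: ler_wpM2l => //.
  rewrite /decay [leRHS]mulrDl.
  by apply: lerD; [exact: bump_t_le|exact: laplacian_bump_le].
apply: (le_trans (young_absorb p1 (mulr_ge0 (normr_ge0 a) w0) d0)).
by rewrite lerD2r powRM// ler_wpM2l ?powR_ge0// weight_powR_le.
Qed.

Lemma bump_ge0 z : 0 <= z.1 <= T -> 0 <= bump z.
Proof.
move=> /ramp01/andP[r0 _]; apply: mulr_ge0; last exact: cutoff_ge0.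
exact: exprn_ge0.
Qed.

Lemma bump_le1 z : 0 <= z.1 <= T -> bump z <= 1.
Proof.
move=> /ramp01/andP[r0 r1]; have /andP[c0 c1] := cut01 z.2.
rewrite /bump /cutoff /pospow; apply: mulr_ile1; rewrite ?exprn_ge0 ?exprn_ile1//.
Qed.

(** On the half-size cylinder both 1 - t / T and 1 - |x|^2 / rho^2 are at least
1/2, hence 4 to the power -(m + 3) below. *)
Lemma bump_ge z : 0 <= z.1 <= T / 2 -> enorm z.2 <= rho / 2 ->
  (4^-1) ^+ m.+3 <= bump z.
Proof.
move=> /andP[z0 zT] zr.
rewrite (_ : 4^-1 = 2^-1 * 2^-1 :> R); last by field.
rewrite exprMn; apply: ler_pM; rewrite ?exprn_ge0 ?invr_ge0//.
  rewrite lerXn2r ?nnegrE ?invr_ge0 ?ramp_ge0//.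
    by apply: (le_trans zT); rewrite ler_pdivrMr// mulr2n mulrDr mulr1 lerDl ltW.
  rewrite /ramp lerBrDr -lerBrDl ler_pdivrMr// (le_trans zT)//.
  by rewrite le_eqVlt; apply/orP; left; apply/eqP; field.
rewrite /cutoff /pospow lerXn2r ?nnegrE ?invr_ge0 ?le_max ?lexx ?orbT//.
apply/orP; left; rewrite lerBrDr -lerBrDl ler_pdivrMr ?exprn_gt0//.
rewrite /sumsq -sqr_enorm (@le_trans _ _ ((rho / 2) ^+ 2))//.
  by rewrite lerXn2r ?nnegrE ?enorm_ge0// divr_ge0// ltW.
rewrite [leLHS](_ : _ = 4^-1 * rho ^+ 2); last by field.
by rewrite ler_wpM2r ?sqr_ge0//; lra.
Qed.

End pointwise_bounds.

(** * The integral estimate for weak solutions *)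

Section product_integrals.
Context d1 d2 (T1 : measurableType d1) (T2 : measurableType d2) (R : realType).
Variables (m1 : {sigma_finite_measure set T1 -> \bar R})
  (m2 : {sigma_finite_measure set T2 -> \bar R}).
Local Open Scope ereal_scope.

(** Tonelli's theorem for a function of the second variable alone, used for the
time-independent source w. *)
Lemma ge0_integral_snd (A : set T1) (B : set T2) (g : T2 -> \bar R) :
  measurable A -> measurable B -> measurable_fun setT g ->
  (forall y, 0 <= g y) ->
  \int[m1 \x m2]_(z in A `*` B) g z.2 = m1 A * \int[m2]_(y in B) g y.
Proof.
move=> mA mB mg g0; have mAB : measurable (A `*` B) by exact: measurableX.
have mgB : measurable_fun setT (g \_ B).
  by apply/(measurable_restrictT g mB); exact: measurable_funS mg.
rewrite integral_mkcond fubini_tonelli1; last 2 first.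
- apply/(measurable_restrictT (g \o snd) mAB).
  by apply: measurable_funTS; apply: measurableT_comp => //; exact: measurable_snd.
- by move=> z; apply: erestrict_ge0.
transitivity (\int[m1]_x ((\1_A x)%:E * \int[m2]_(y in B) g y)).
  apply: eq_integral => x _; rewrite /fubini_F.
  have [xA|xA] := boolP (x \in A).
    rewrite indicE xA mul1e [RHS]integral_mkcond; apply: eq_integral => y _.
    rewrite !patchE; congr (if _ then _ else _).
    apply/idP/idP => [|yB]; first by rewrite !inE => -[].
    by apply/mem_set; split; exact/set_mem.
  rewrite indicE (negbTE xA) mul0e; apply: integral0_eq => y _.
  by rewrite patchE; case: ifPn => //; rewrite inE => -[/= /mem_set]; rewrite (negbTE xA).
rewrite ge0_integralZr//.
- by rewrite integral_indic// setIT.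
- by apply/measurable_EFinP; exact: measurable_indic.
- by apply: integral_ge0.
Qed.

Lemma ae_snd (P : T2 -> Prop) :
  {ae m2, forall y, P y} -> {ae m1 \x m2, forall z, P z.2}.
Proof.
move=> [Z [mZ Z0 PZ]]; exists (setT `*` Z); split.
- exact: measurableX.
- by rewrite product_measure1E// Z0 mule0.
- by move=> z /= nPz; split => //; exact: PZ.
Qed.

End product_integrals.

Section bounded_multiplier.
Context d (T : measurableType d) (R : realType) (mu : {measure set T -> \bar R}).

Lemma integrable_mul_bounded (D : set T) (f h : T -> R) (C : R) :
  measurable D -> mu.-integrable D (EFin \o f) -> measurable_fun D h ->
  (forall x, D x -> `|h x| <= C) ->
  mu.-integrable D (EFin \o (fun x => f x * h x)).
Proof.
move=> mD if_ mh hC.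
apply: (@le_integrable _ _ _ _ _ mD _ (fun x => C%:E * (EFin \o f) x)%E).
- apply/measurable_EFinP; apply: measurable_funM => //.
  exact/measurable_EFinP/(measurable_int mu).
- move=> x Dx; rewrite /= lee_fin normrM mulrC normrM ler_wpM2r//.
  by rewrite (le_trans (hC _ Dx))// ler_norm.
- exact: integrableZl.
Qed.

End bounded_multiplier.

Section weak_solution.
Context (R : realType) (N : nat) (p : R) (w u0 : 'rV[R]_N -> R)
  (u : R * 'rV[R]_N -> R).
Local Notation space := 'rV[R]_N.
Local Notation dx := (lebesgue_rV R N).
Local Notation dtdx := (@lebesgue_measure R \x lebesgue_rV R N)%E.
Hypotheses (p1 : 1 < p) (hw : L1loc w) (w_ge0 : {ae dx, forall x, 0 <= w x})
  (hu0 : L1loc u0) (u0_ge0 : {ae dx, forall x, 0 <= u0 x})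
  (hu : global_weak_solution p w u0 u).
Variables (T rho : R) (m : nat).
Hypotheses (T0 : 0 < T) (rho0 : 0 < rho) (mp : m.+3%:R <= p * m.+1%:R).

Local Notation phi := (@bump R N T rho m).
Local Notation phi_t := (@bump_t R N T rho m).

(** All integrals are taken over the bounded cylinder D, outside of which the test
   function and its derivatives vanish. *)
Let D : set (measurableTypeR R * space) := `]0, T[%classic `*` @box R N rho.

Let mD : measurable D.
Proof. by apply: measurableX => //; exact: measurable_box. Qed.

Let DT z : D z -> 0 <= z.1 <= T.
Proof. by move=> [/=]; rewrite in_itv/= => /andP[/ltW -> /ltW ->]. Qed.

Let length_itv (a : R) : 0 < a ->
  lebesgue_measure (`]0%R, a[%classic : set (measurableTypeR R)) = a%:E.
Proof. by move=> a0; rewrite lebesgue_measure_itv/= lte_fin a0 sube0. Qed.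

Let muD : dtdx D = (T * (rho *+ 2) ^+ N)%:E.
Proof.
rewrite product_measure1E//; last exact: measurable_box.
rewrite EFinM; congr (_ * _)%E; first exact: length_itv.
exact: lebesgue_rV_boxE.
Qed.

Let muD_lty : (dtdx D < +oo)%E. Proof. by rewrite muD ltry. Qed.

Let DS : D `<=` open_slab T.
Proof. by move=> z [/=]; rewrite in_itv. Qed.

(** Extended by zero, the two integrands are the same function. *)
Let integral_slab (f : R * space -> R) :
  (forall z, ~ @box R N rho z.2 -> f z = 0) ->
  \int[dtdx]_(z in open_slab T) f z = \int[dtdx]_(z in D) f z.
Proof.
move=> f0; rewrite Rintegral_mkcond [RHS]Rintegral_mkcond.
apply: eq_Rintegral => z _; rewrite !patchE.
case: ifPn => zS; case: ifPn => zD //.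
- apply: f0 => zb; move: zD; rewrite notin_setE; apply; split => //=.
  by move: zS; rewrite inE /open_slab/= in_itv.
- by move: zS; rewrite notin_setE => zS; case: zS; apply: DS; exact/set_mem.
Qed.

Let phi0 n (z : R * space) : ~ @box R N rho z.2 -> cutoff rho n.+1 z.2 = 0.
Proof. exact: cutoff_box. Qed.

Let mu_ : measurable_fun D u.
Proof.
have [[+ _] _ _] := hu; apply: measurable_funS.
  rewrite (_ : @half_space R N = `[0, +oo[%classic `*` setT).
    exact: measurableX.
  by apply/seteqP; split => z; rewrite /half_space/= in_itv/= andbT => // -[].
by move=> z /DT/andP[].
Qed.

Let iup : dtdx.-integrable D (fun z => (`|u z| `^ p)%:E).
Proof.
have [[_ +] _ _] := hu; move=> /(_ (`[0, T]%classic `*` @box R N rho)) H.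
apply: integrableS (H _ _) => //.
- by apply: measurableX => //; exact: measurable_box.
- move=> z [/= zT zb]; split => //=.
  by move: zT; rewrite !in_itv/= => /andP[/ltW -> /ltW ->].
- by apply: compact_setX; [exact: segment_compact|exact: compact_box].
- by move=> z [/=]; rewrite in_itv/= => /andP[].
Qed.

Let icst c : dtdx.-integrable D (EFin \o cst c).
Proof.
apply: measurable_bounded_integrable => //.
by exists `|c|; split => // M cM z _ /=; exact: ltW.
Qed.

Let iu : dtdx.-integrable D (EFin \o u).
Proof.
apply: (le_integrable mD _ _ (integrableD mD (icst 1) iup)).
  exact/measurable_EFinP.
move=> z _ /=; rewrite lee_fin [leRHS]ger0_norm; last by rewrite addr_ge0// powR_ge0.
have [u1|u1] := leP `|u z| 1; first by rewrite (le_trans u1)// lerDl powR_ge0.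
by rewrite (le_trans (le1r_powR (ltW u1) (ltW p1)))// lerDr.
Qed.

Let mw : measurable_fun setT w. Proof. by case: hw. Qed.

Let iw : dtdx.-integrable D (EFin \o (fun z => w z.2)).
Proof.
apply/integrableP; split.
  apply/measurable_EFinP; apply: measurable_funTS.
  by apply: (measurableT_comp mw); exact: measurable_snd.
rewrite (ge0_integral_snd (@lebesgue_measure R) dx (g := fun y => `|(w y)%:E|%E))//.
- rewrite [X in (X * _)%E](_ : _ = T%:E); last exact: length_itv.
  rewrite lte_mul_pinfty//.
    by rewrite lee_fin ltW.
  have [_ /(_ _ (@compact_box R N rho))] := hw.
  by move=> /integrableP[].
- exact: measurable_box.
- by apply: measurableT_comp => //; exact/measurable_EFinP.
Qed.

Let mramp : @measurable_fun _ _ (measurableTypeR R * space)%type _ setT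
  (fun z => ramp T z.1).
Proof. by apply: measurable_funB => //; exact: measurable_funM. Qed.

Let msumsq : @measurable_fun _ _ (measurableTypeR R * space)%type _ setT
  (fun z => sumsq z.2).
Proof.
apply: measurable_sum => i; apply: measurable_funX.
by apply: (measurableT_comp (measurable_coord i)); exact: measurable_snd.
Qed.

Let mcut n : @measurable_fun _ _ (measurableTypeR R * space)%type _ setT
  (fun z => cutoff rho n z.2).
Proof.
apply: measurable_funX; apply: measurable_maxr => //.
apply: measurable_funB => //; exact: measurable_funM.
Qed.

Let mphi : @measurable_fun _ _ (measurableTypeR R * space)%type _ setT phi.
Proof. by apply: measurable_funM; [exact: measurable_funX|exact: mcut]. Qed.

Let mphit : @measurable_fun _ _ (measurableTypeR R * space)%type _ setT phi_t.
Proof.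
apply: measurable_funM; last exact: mcut.
by apply: measurable_funM => //; exact: measurable_funX.
Qed.

Let mlap : @measurable_fun _ _ (measurableTypeR R * space)%type _ setT
  (laplacian phi).
Proof.
rewrite (_ : laplacian phi = fun z =>
    - (2 * m.+3%:R / rho ^+ 2) * ramp T z.1 ^+ m.+3 *
    (cutoff rho m.+2 z.2 * N%:R -
     2 * m.+2%:R / rho ^+ 2 * cutoff rho m.+1 z.2 * sumsq z.2)); last first.
  by apply/funext => z; exact: laplacian_bump.
apply: measurable_funM.
  by apply: measurable_funM => //; exact: measurable_funX.
apply: measurable_funB; first by apply: measurable_funM => //; exact: mcut.
by apply: measurable_funM => //; apply: measurable_funM => //; exact: mcut.
Qed.

Let phi_bound z : D z -> `|phi z| <= 1.
Proof. by move=> /DT zT; rewrite ger0_norm ?bump_ge0// bump_le1. Qed.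

Let weight_le1 z : D z -> weight T rho m z <= 1.
Proof.
move=> /DT zT.
have := zT => /andP[z0 zT'].
have c0 := @cutoff_ge0 R N rho 1 z.2.
rewrite /weight; apply: mulr_ile1.
- by rewrite exprn_ge0// ramp_ge0.
- exact: cutoff_ge0.
- by rewrite exprn_ile1 ?ramp_ge0 ?ramp_le1.
- rewrite /cutoff /pospow exprn_ile1 ?le_max ?lexx ?orbT//.
  by rewrite ge_max ler01 andbT gerBl divr_ge0 ?sqr_ge0// sumsq_ge0.
Qed.

Let iupphi : dtdx.-integrable D (EFin \o (fun z => `|u z| `^ p * phi z)).
Proof.
apply: (integrable_mul_bounded mD iup) phi_bound.
exact: measurable_funTS.
Qed.

Let iwphi : dtdx.-integrable D (EFin \o (fun z => w z.2 * phi z)).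
Proof.
apply: (integrable_mul_bounded mD iw) phi_bound.
exact: measurable_funTS.
Qed.

Let iuphit : dtdx.-integrable D (EFin \o (fun z => u z * phi_t z)).
Proof.
apply: (@integrable_mul_bounded _ _ _ _ _ _ _ (m.+3%:R / T) mD iu).
  exact: measurable_funTS.
move=> z Dz; rewrite (le_trans (bump_t_le rho m T0 (DT Dz)))//.
by rewrite ler_piMr ?weight_le1// divr_ge0// ltW.
Qed.

Let iulap : dtdx.-integrable D (EFin \o (fun z => u z * laplacian phi z)).
Proof.
apply: (@integrable_mul_bounded _ _ _ _ _ _ _
  (2 * m.+3%:R * (N%:R + 2 * m.+2%:R) / rho ^+ 2) mD iu).
  exact: measurable_funTS.
move=> z Dz; rewrite (le_trans (laplacian_bump_le m T0 rho0 (DT Dz)))//.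
by rewrite ler_piMr ?weight_le1// divr_ge0// sqr_ge0.
Qed.

Let initial_ge0 : 0 <= \int[dx]_x (u0 x * phi (0, x)).
Proof.
apply: fine_ge0.
have mu0 : measurable_fun setT u0 by case: hu0.
have mphi0 : measurable_fun setT (fun x : space => phi (0, x)).
  exact: (measurableT_comp mphi (pair1_measurable (0 : measurableTypeR R))).
rewrite (ae_eq_integral (fun x => (Num.max (u0 x) 0 * phi (0, x))%:E))//.
- apply: integral_ge0 => x _; rewrite lee_fin mulr_ge0 ?le_max ?lexx ?orbT//.
  by rewrite bump_ge0//= lexx ltW.
- by apply/measurable_EFinP; exact: measurable_funM.
- apply/measurable_EFinP; apply: measurable_funM => //.
  exact: measurable_maxr.
- by apply: filterS u0_ge0 => x ux _; congr (_ * _)%:E; apply/esym/max_idPl.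
Qed.

(** The terms in phi_t and Delta phi are absorbed by the reaction term, which is a
   finite quantity and cancels; the initial term is dropped by its sign. *)
Let source_le : \int[dtdx]_(z in D) (w z.2 * phi z) <=
  decay N T rho m `^ (p / (p - 1)) * (T * (rho *+ 2) ^+ N).
Proof.
have [_ _ /(_ T phi T0 (test_function_bump N m T0 rho0))] := hu.
rewrite time_deriv_bump//.
rewrite integral_slab; last first.
  by move=> z zb; rewrite /bump phi0// !mulr0.
rewrite (integral_slab (f := fun z => u z * phi_t z)); last first.
  by move=> z zb; rewrite /bump_t phi0// !mulr0.
rewrite (integral_slab (f := fun z => u z * laplacian phi z)); last first.
  by move=> z zb; rewrite laplacian_bump// !phi0// !(mul0r, mulr0) subrr mulr0 mulr0.
rewrite [X in X + _ = _](_ : _ =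
  \int[dtdx]_(z in D) (`|u z| `^ p * phi z + w z.2 * phi z)); last first.
  by apply: eq_Rintegral => z _; rewrite mulrDl.
rewrite RintegralD// => eq1.
have A1 : - (\int[dtdx]_(z in D) (u z * phi_t z)) <= \int[dtdx]_(z in D) `|u z * phi_t z|.
  by apply: (le_trans (ler_norm _)); rewrite normrN; exact: le_normr_Rintegral.
have A2 : - (\int[dtdx]_(z in D) (u z * laplacian phi z)) <=
    \int[dtdx]_(z in D) `|u z * laplacian phi z|.
  by apply: (le_trans (ler_norm _)); rewrite normrN; exact: le_normr_Rintegral.
have i1 := integrable_norm iuphit.
have i2 := integrable_norm iulap.
have A3 : \int[dtdx]_(z in D) `|u z * phi_t z| +
    \int[dtdx]_(z in D) `|u z * laplacian phi z| <=
    \int[dtdx]_(z in D) (`|u z| `^ p * phi z) +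
    decay N T rho m `^ (p / (p - 1)) * (T * (rho *+ 2) ^+ N).
  rewrite -RintegralD//.
  have -> : decay N T rho m `^ (p / (p - 1)) * (T * (rho *+ 2) ^+ N) =
      \int[dtdx]_(z in D) (decay N T rho m `^ (p / (p - 1))).
    rewrite Rintegral_cst//; congr (_ * _); exact/esym/(congr1 fine muD).
  rewrite -RintegralD//; last exact: icst.
  apply: le_Rintegral => //.
  - exact: (integrableD mD i1 i2).
  - exact: (integrableD mD iupphi (icst _)).
  - by move=> z Dz; apply: bump_absorb => //; exact: DT.
have A4 : (\int[dtdx]_(z in D) (`|u z| `^ p * phi z) +
    \int[dtdx]_(z in D) (w z.2 * phi z)) + \int[dx]_x (u0 x * phi (0, x)) <=
    \int[dtdx]_(z in D) `|u z * phi_t z| +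
    \int[dtdx]_(z in D) `|u z * laplacian phi z|.
  by rewrite eq1; exact: lerD A1 A2.
have := le_trans A4 A3; rewrite -addrA lerD2l.
by apply: le_trans; rewrite lerDl.
Qed.

(** Tonelli's theorem on the half-size cylinder, for the positive part of w. *)
Let source_ge : (4^-1) ^+ m.+3 * (T / 2) * ball_mass w (rho / 2) <=
  \int[dtdx]_(z in D) (w z.2 * phi z).
Proof.
pose wp x := Num.max (w x) 0.
have wp0 x : 0 <= wp x by rewrite le_max lexx orbT.
have mwp : measurable_fun setT wp by exact: measurable_maxr.
have mwp2 : @measurable_fun _ _ (measurableTypeR R * space)%type _ setT
    (fun z => wp z.2).
  by apply: (measurableT_comp mwp); exact: measurable_snd.
pose E : set (measurableTypeR R * space) :=
  `]0, T / 2[%classic `*` @eball R N (rho / 2).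
have mE : measurable E by apply: measurableX => //; exact: measurable_eball.
have ED : E `<=` D.
  move=> z [/= zT zr]; split => /=.
    move: zT; rewrite !in_itv/= => /andP[-> /lt_le_trans]; apply.
    by rewrite ler_pdivrMr// ler_peMr ?ler1n// ltW.
  apply: eball_box; rewrite /eball/= (le_trans zr)//.
  by rewrite ler_pdivrMr// ler_peMr ?ler1n// ltW.
have -> : \int[dtdx]_(z in D) (w z.2 * phi z) =
    fine (\int[dtdx]_(z in D) (wp z.2 * phi z)%:E).
  congr fine; apply: ae_eq_integral => //.
  - exact: measurable_int iwphi.
  - by apply/measurable_EFinP; apply: measurable_funTS; exact: measurable_funM.
  - have := ae_snd (@lebesgue_measure R) w_ge0.
    by apply: filterS => z wz _ /=; congr (_ * _)%:E; apply/esym/max_idPl.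
have fin : (\int[dtdx]_(z in D) (wp z.2 * phi z)%:E)%E \is a fin_num.
  rewrite [X in X \is a _](_ : _ = \int[dtdx]_(z in D) (w z.2 * phi z)%:E)%E.
    exact: integrable_fin_num.
  apply: ae_eq_integral => //.
  - by apply/measurable_EFinP; apply: measurable_funTS; exact: measurable_funM.
  - exact: measurable_int iwphi.
  - have := ae_snd (@lebesgue_measure R) w_ge0.
    by apply: filterS => z wz _ /=; congr (_ * _)%:E; apply/max_idPl.
rewrite -lee_fin fineK//.
apply: (@le_trans _ _ (\int[dtdx]_(z in E) (wp z.2 * phi z)%:E)%E); last first.
  apply: ge0_subset_integral => //.
  - by apply/measurable_EFinP; apply: measurable_funTS; exact: measurable_funM.
  - by move=> z /DT zT; rewrite lee_fin mulr_ge0// bump_ge0.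
apply: (@le_trans _ _ (\int[dtdx]_(z in E) (((4^-1) ^+ m.+3)%:E * (wp z.2)%:E))%E); last first.
  apply: ge0_le_integral => //.
  - by move=> z _; rewrite mule_ge0// lee_fin ?exprn_ge0 ?invr_ge0.
  - apply/measurable_EFinP; apply: measurable_funTS.
    exact: measurable_funM.
  - by apply/measurable_EFinP; apply: measurable_funTS; exact: measurable_funM.
  - move=> z Ez; rewrite -EFinM lee_fin mulrC ler_wpM2l//.
    apply: bump_ge => //; last by case: Ez.
    by case: Ez => /= + _; rewrite in_itv/= => /andP[/ltW -> /ltW ->].
rewrite ge0_integralZl//; last 2 first.
- by apply/measurable_EFinP; exact: measurable_funTS.
- by move=> z _; rewrite lee_fin.
rewrite (ge0_integral_snd (@lebesgue_measure R) dx (g := fun x => (wp x)%:E))//.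
- rewrite ball_massE// [X in (_ * (X * _))%E](_ : _ = (T / 2)%:E); last first.
    by apply: length_itv; rewrite divr_gt0.
  by rewrite -!EFinM mulrA.
- exact: measurable_eball.
- exact/measurable_EFinP.
Qed.

Lemma ball_mass_le_decay : ball_mass w (rho / 2) <=
  2 * 4 ^+ m.+3 * decay N T rho m `^ (p / (p - 1)) * (rho *+ 2) ^+ N.
Proof.
have := le_trans source_ge source_le.
have c0 : 0 < (4^-1) ^+ m.+3 * (T / 2) :> R.
  by rewrite mulr_gt0 ?divr_gt0// exprn_gt0// invr_gt0.
rewrite -ler_pdivlMl// => /le_trans; apply.
rewrite le_eqVlt; apply/orP; left; apply/eqP.
rewrite exprVn; field.
by rewrite !gt_eqF// exprn_gt0.
Qed.

End weak_solution.

(** * Nonexistence and the theorem *)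

Section nonexistence.
Context (R : realType) (N : nat).
Variables (w : 'rV[R]_N -> R) (hw : L1loc w).
Hypothesis w_ge0 : {ae lebesgue_rV R N, forall x, 0 <= w x}.

(** The parabolic choice T = rho^2 balances the two parts of [decay], which becomes
a multiple of rho^-2; m is taken so large that m + 3 <= p (m + 1). *)
Lemma weak_solution_growth (p : R) (u0 : 'rV[R]_N -> R) u : 1 < p ->
  L1loc u0 -> {ae lebesgue_rV R N, forall x, 0 <= u0 x} ->
  global_weak_solution p w u0 u ->
  exists C : R, forall rho, 0 < rho ->
    ball_mass w (rho / 2) <= C * rho `^ (N%:R - 2 * (p / (p - 1))).
Proof.
move=> p1 hu0 u0_ge0 hu; have pm : 0 < p - 1 by rewrite subr_gt0.
pose m := Num.Def.archi_bound (2 / (p - 1)).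
have mp : m.+3%:R <= p * m.+1%:R.
  have : 2 / (p - 1) < m%:R by rewrite archi_boundP// divr_ge0// ltW.
  rewrite ltr_pdivrMr// => H.
  have -> : m.+3%:R = m.+1%:R + 2 :> R by rewrite -natrD addn2.
  rewrite -lerBrDl -[X in _ - X]mul1r -mulrBl mulrC (le_trans (ltW H))//.
  by rewrite ler_wpM2r ?ler_nat// ltW.
pose C2 : R := m.+3%:R + 2 * m.+3%:R * (N%:R + 2 * m.+2%:R).
have C20 : 0 <= C2 by rewrite addr_ge0// !mulr_ge0// addr_ge0.
pose q := p / (p - 1).
exists (2 * 4 ^+ m.+3 * C2 `^ q * 2 ^+ N) => rho rho0.
have rho2 : 0 < rho ^+ 2 by rewrite exprn_gt0.
have := ball_mass_le_decay p1 hw w_ge0 hu0 u0_ge0 hu rho2 rho0 mp.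
move=> /le_trans; apply.
have -> : decay N (rho ^+ 2) rho m = C2 * rho `^ (- 2).
  rewrite powRN powR_mulrn ?(ltW rho0)// /decay /C2.
  by field; rewrite gt_eqF.
rewrite -/q powRM ?powR_ge0// -powRrM.
rewrite [in leRHS]powRD; last by rewrite (gt_eqF rho0) implybT.
rewrite -[rho *+ 2]mulr_natr exprMn -(powR_mulrn N (ltW rho0)).
rewrite -mulNr le_eqVlt; apply/orP; left; apply/eqP.
by ring.
Qed.

Lemma subcritical_exponent (p : R) : (3 <= N)%N -> 1 < p ->
  (p <= N%:R / (N%:R - 2) -> N%:R - 2 * (p / (p - 1)) <= 0) /\
  (p < N%:R / (N%:R - 2) -> N%:R - 2 * (p / (p - 1)) < 0).
Proof.
move=> N3 p1; have pm : 0 < p - 1 by rewrite subr_gt0.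
have N2 : 0 < N%:R - 2 :> R by rewrite subr_gt0 ltr_nat.
rewrite subr_le0 subr_lt0 mulrA ler_pdivlMr// ltr_pdivlMr//.
by rewrite ler_pdivlMr// ltr_pdivlMr//; split; nra.
Qed.

Lemma no_solution_subcritical (p M : R) : 1 < p ->
  N%:R - 2 * (p / (p - 1)) < 0 -> 0 < M ->
  ball_mass w r @[r --> +oo] --> M -> no_global_weak_solution p w.
Proof.
move=> p1 q0 M0 FM u0 hu0 u0_ge0 [u hu].
have [C HC] := weak_solution_growth p1 hu0 u0_ge0 hu.
pose a := - (N%:R - 2 * (p / (p - 1))).
have a0 : 0 < a by rewrite oppr_gt0.
have F2 : ball_mass w (t * 2^-1) @[t --> +oo] --> M.
  by apply: cvg_comp_scale => //; rewrite invr_gt0.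
have C0 : C * (t `^ a)^-1 @[t --> +oo] --> C * 0.
  apply: cvgM; first exact: cvg_cst.
  apply/gtr0_cvgV0; last exact: cvg_powR_pinfty.
  by near=> t; rewrite powR_gt0//; near: t; exact: nbhs_pinfty_gt.
suff : M <= C * 0 by rewrite mulr0 leNgt M0.
apply: (ler_cvg_to F2 C0); near=> t.
rewrite -powRN opprK; apply: HC.
by near: t; exact: nbhs_pinfty_gt.
Unshelve. all: by end_near. Qed.

Lemma no_solution_critical (p : R) : 1 < p ->
  N%:R - 2 * (p / (p - 1)) <= 0 ->
  ball_mass w r @[r --> +oo] --> +oo -> no_global_weak_solution p w.
Proof.
move=> p1 q0 Foo u0 hu0 u0_ge0 [u hu].
have [C HC] := weak_solution_growth p1 hu0 u0_ge0 hu.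
have F2 : ball_mass w (t * 2^-1) @[t --> +oo] --> +oo.
  apply: (@cvg_comp _ _ _ (fun t => t * 2^-1) (ball_mass w) _ _ _ _ Foo).
  by apply: gt0_cvgMly; [rewrite invr_gt0|exact: cvg_id].
suff : \forall t \near (@pinfty_nbhs R), (False : Prop).
  by move=> /filter_ex[].
near=> t.
have t1 : 1 <= t by near: t; exact: nbhs_pinfty_ge.
have CF : `|C| < ball_mass w (t * 2^-1) by near: t; move/cvgryPgt : F2; exact.
have := lt_le_trans CF (HC t (lt_le_trans ltr01 t1)).
rewrite ltNge => /negP; apply.
apply: (@le_trans _ _ (`|C| * t `^ (N%:R - 2 * (p / (p - 1))))).
  by rewrite ler_wpM2r ?powR_ge0// ler_norm.
by rewrite ler_piMr// -[leRHS](powRr0 t); exact: ler_powR.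
Unshelve. all: by end_near. Qed.

End nonexistence.

Theorem theorem5p1 (R : realType) (N : nat) (hN : (0 < N)%N)
    (w : 'rV[R]_N -> R) (hw : L1loc w)
    (w_ge0 : {ae lebesgue_rV R N, forall x, 0 <= w x}) :
  [/\ forall M : R, 0 < M ->
        ((ball_mass w r @[r --> +oo] --> M) <->
         ((lebesgue_rV R N).-integrable [set: 'rV[R]_N] (EFin \o w) /\
          \int[lebesgue_rV R N]_x w x = M)) /\
        (ball_mass w r @[r --> +oo] --> M ->
         [/\ RV_with_factor 0 (ball_mass w) (ball_mass w),
             ball_mass w r @[r --> +oo] --> M
           & (3 <= N)%N -> forall p : R, 1 < p < N%:R / (N%:R - 2) ->
             no_global_weak_solution p w]),
      forall gamma c : R, 0 < gamma < N%:R -> 0 < c ->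
        asymp_equiv (spherical_mean w) (fun r => c * r `^ (- (N%:R - gamma))) ->
        [/\ asymp_equiv (ball_mass w)
              (fun r => c * sphere_area R N / gamma * r `^ gamma),
            RV_with_factor gamma (ball_mass w)
              (fun r => r `^ (- gamma) * ball_mass w r)
          & r `^ (- gamma) * ball_mass w r @[r --> +oo] -->
              c * sphere_area R N / gamma]
    & forall c : R, 0 < c ->
        asymp_equiv (spherical_mean w) (fun r => c * r `^ (- N%:R)) ->
        [/\ asymp_equiv (ball_mass w) (fun r => c * sphere_area R N * ln r),
            RV_with_factor 0 (ball_mass w) (ball_mass w),
            ball_mass w r @[r --> +oo] --> +oo
          & (3 <= N)%N -> forall p : R, 1 < p <= N%:R / (N%:R - 2) ->
            no_global_weak_solution p w]].
Proof.
have mF := measurable_ball_mass hw w_ge0.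
split.
- move=> M M0; split; first exact: ball_mass_cvg_integrable.
  move=> FM; split => //; first by apply: RV0_factor; exact: RV_cvg M0 FM.
  move=> N3 p /andP[p1 pN].
  apply: (no_solution_subcritical hw w_ge0 p1 _ M0 FM).
  by have [_] := subcritical_exponent N3 p1; exact.
- move=> gamma c /andP[g0 _] c0 wc.
  have FC := ball_mass_asymp_power hN hw g0 c0 wc.
  have C0 : 0 < c * sphere_area R N / gamma.
    by rewrite divr_gt0// mulr_gt0// sphere_area_gt0.
  by have [] := RV_power mF C0 FC.
- move=> c c0 wc.
  have FC := ball_mass_asymp_log hN hw c0 wc.
  have C0 : 0 < c * sphere_area R N by rewrite mulr_gt0// sphere_area_gt0.
  have [RV0F Foo] := RV_log mF C0 FC.
  split => //; first exact: RV0_factor.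
  move=> N3 p /andP[p1 pN].
  apply: (no_solution_critical hw w_ge0 p1 _ Foo).
  by have [+ _] := subcritical_exponent N3 p1; exact.
Qed.
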